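(* Let $m>1$, $0<\kappa\le1$ and $0<\alpha\le1$. If $s<\max\left\{\frac14,\frac{1-\alpha}{2},\frac{1-m\alpha\kappa}{2}\right\}$, then there exist $\gamma\in\Gamma(\kappa)$ and an $\alpha$-dimensional measure $\mu$ on $\mathbb R$ such that there is no constant $C$ for which $$\left(\int_{-1}^1\sup_{t\in[-1,1]}|S_tf(\gamma(x,t))|^2\,d\mu(x)\right)^{\frac12}\le C\|f\|_{H^s}$$ holds for all $f\in H^s(\mathbb R)$.
   Context: For $0<\alpha\le1$, a positive Borel measure $\mu$ on $\mathbb R$ is called $\alpha$-dimensional if there is a constant $c$ such that $\mu(\mathbb B(x,r))\le c\,r^\alpha$ for all $x\in\mathbb R$ and $r>0$, where $\mathbb B(x,r)$ is the ball (interval) centered at $x$ with radius $r$. For $0<\kappa\le1$, $\Gamma(\kappa)$ is the collection of continuous functions $\gamma:\mathbb R\times[-1,1]\to\mathbb R$ with $\gamma(x,0)=x$ for which there are constants $C_1,C_2>0$ such that $|\gamma(x,t)-\gamma(x,t')|\le C_1|t-t'|^\kappa$ for all $x\in\mathbb R$, $t,t'\in[-1,1]$, and $\frac1{C_2}|x-x'|\le|\gamma(x,t)-\gamma(x',t)|\le C_2|x-x'|$ for all $t\in[-1,1]$, $x,x'\in\mathbb R$. $H^s(\mathbb R)$ is the Sobolev space with norm $\|f\|_{H^s}=\|(1-\Delta)^{s/2}f\|_{L^2(\mathbb R)}$, and $\widehat f(\xi)=\int_{\mathbb R}e^{-ix\xi}f(x)\,dx$. The evolution operator is $$S_tf(x)=\frac1{2\pi}\int_{\mathbb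 R}e^{i(x\xi+t|\xi|^m)}\widehat f(\xi)\,d\xi .$$ When $\widehat f$ is not integrable, the value $S_tf(y)$ is understood as $\lim_{k\to\infty}\frac1{2\pi}\int_{|\xi|\le 2^k}e^{i(y\xi+t|\xi|^m)}\widehat f(\xi)\,d\xi$. *)

(* Defs.v *)
From HB Require Import structures.
From mathcomp Require Import all_boot all_order all_algebra.
From mathcomp Require Import all_classical all_reals all_analysis.
From mathcomp Require Import complex.
Set Implicit Arguments.
Unset Strict Implicit.
Unset Printing Implicit Defensive.
Import Order.TTheory GRing.Theory Num.Theory.
Import numFieldNormedType.Exports.
Local Open Scope classical_set_scope.
Local Open Scope ring_scope.
Local Open Scope complex_scope.

(* R[i] carries neither a topology nor a measurable structure in the libraries
   used here, so limits, derivatives and integrals of complex-valued functions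
   are taken on real and imaginary parts. *)
Definition re (R : realType) (f : R -> R[i]) : R -> R := fun x => complex.Re (f x).
Definition im (R : realType) (f : R -> R[i]) : R -> R := fun x => complex.Im (f x).
Definition cabs (R : realType) (z : R[i]) : R := ComplexField.Normc.normc z.

Definition cmeasurable (R : realType) (f : R -> R[i]) : Prop :=
  measurable_fun [set: measurableTypeR R] (re f) /\
  measurable_fun [set: measurableTypeR R] (im f).

Definition cintegrable (R : realType) (f : R -> R[i]) : Prop :=
  (@lebesgue_measure R).-integrable setT (EFin \o re f) /\
  (@lebesgue_measure R).-integrable setT (EFin \o im f).

Definition cint (R : realType) (D : set R) (f : R -> R[i]) : R[i] :=
  (\int[@lebesgue_measure R]_(x in D) re f x)%R +i*
  (\int[@lebesgue_measure R]_(x in D) im f x)%R.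

(* By convention, 0 at divergent sequences. *)
Definition clim (R : realType) (z : nat -> R[i]) : R[i] :=
  let zr := (fun k => complex.Re (z k)) : nat -> R in
  let zi := (fun k => complex.Im (z k)) : nat -> R in
  if `[< cvgn zr /\ cvgn zi >] then limn zr +i* limn zi else 0.

(* e^{i theta} *)
Definition cis (R : realType) (theta : R) : R[i] := cos theta +i* sin theta.

Definition L2norm (R : realType) (u : R -> R[i]) : \bar R :=
  Lnorm (@lebesgue_measure R) 2%:E (fun x => (cabs (u x))%:E).

Definition in_L2 (R : realType) (u : R -> R[i]) : Prop :=
  cmeasurable u /\ (L2norm u < +oo)%E.

Definition fourier (R : realType) (f : R -> R[i]) : R -> R[i] :=
  fun xi => cint setT (fun x => cis (- (x * xi)) * f x).

(* [schwartz_bound N M f] : every seminorm sup_x |x^j f^(k)(x)| with j, k <= N,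
   of the real and of the imaginary part, is at most M. *)
Definition schwartz_bound (R : realType) (N : nat) (M : R) (f : R -> R[i]) : Prop :=
  forall j k : nat, (j <= N)%N -> (k <= N)%N -> forall x : R,
    `|x ^+ j * derive1n k (re f) x| <= M /\ `|x ^+ j * derive1n k (im f) x| <= M.

Definition schwartz (R : realType) (f : R -> R[i]) : Prop :=
  (forall (k : nat) (x : R),
     derivable (derive1n k (re f)) x 1 /\ derivable (derive1n k (im f)) x 1) /\
  (forall N : nat, exists M : R, schwartz_bound N M f).

(* Tempered distributions are functionals on all functions R -> R[i] of which
   only the values at Schwartz functions are meaningful. *)
Definition tempered (R : realType) (T : (R -> R[i]) -> R[i]) : Prop :=
  (forall (a : R[i]) (phi psi : R -> R[i]), schwartz phi -> schwartz psi ->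
     T (fun x => a * phi x + psi x) = a * T phi + T psi) /\
  (exists (N : nat) (C : R), forall (phi : R -> R[i]) (M : R),
     schwartz phi -> schwartz_bound N M phi -> cabs (T phi) <= C * M).

Definition fun_dist (R : realType) (g : R -> R[i]) : (R -> R[i]) -> R[i] :=
  fun phi => cint setT (fun x => g x * phi x).

Definition fourier_dist (R : realType) (T : (R -> R[i]) -> R[i]) :
    (R -> R[i]) -> R[i] :=
  fun phi => T (fourier phi).

(* [fourier_fun f fhat] : the distributional Fourier transform of f is (given by)
   the function fhat; fhat is determined by f up to a null set. *)
Definition fourier_fun (R : realType) (f : (R -> R[i]) -> R[i])
    (fhat : R -> R[i]) : Prop :=
  cmeasurable fhat /\
  forall phi : R -> R[i], schwartz phi ->
    cintegrable (fun xi => fhat xi * phi xi) /\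
    fourier_dist f phi = fun_dist fhat phi.

(* [bessel_potential s f u] : (1 - Delta)^{s/2} f is the L^2 function u, where
   (1 - Delta)^{s/2} is the Fourier multiplier (1 + xi^2)^{s/2}. *)
Definition bessel_potential (R : realType) (s : R) (f : (R -> R[i]) -> R[i])
    (u : R -> R[i]) : Prop :=
  in_L2 u /\
  forall phi : R -> R[i], schwartz phi ->
    fourier_dist (fun_dist u) phi =
    fourier_dist f (fun xi => ((1 + xi ^+ 2) `^ (s / 2))%:C * phi xi).

Definition sobolev (R : realType) (s : R) (f : (R -> R[i]) -> R[i]) : Prop :=
  tempered f /\ exists u : R -> R[i], bessel_potential s f u.

(* u = (1 - Delta)^{s/2} f is unique up to a null set, so that the infimum ranges
   over the single value ||u||_{L^2}. *)
Definition sobolev_norm (R : realType) (s : R) (f : (R -> R[i]) -> R[i]) : \bar R :=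
  ereal_inf [set L2norm u | u in [set u | bessel_potential s f u]].

(* S_t f(y), as a function of fhat. *)
Definition evolution_integral (R : realType) (m : R) (fhat : R -> R[i])
    (D : set R) (t y : R) : R[i] :=
  ((2 * pi)^-1)%:C * cint D (fun xi => cis (y * xi + t * `|xi| `^ m) * fhat xi).

Definition evolution (R : realType) (m : R) (fhat : R -> R[i]) (t y : R) : R[i] :=
  if `[< cintegrable fhat >] then evolution_integral m fhat setT t y
  else clim (fun k : nat =>
         evolution_integral m fhat [set xi : R | `|xi| <= 2 ^+ k] t y).

Definition dimensional (R : realType) (alpha : R)
    (mu : {measure set (measurableTypeR R) -> \bar R}) : Prop :=
  exists c : R, forall x r : R, 0 < r ->
    (mu (ball x r) <= (c * r `^ alpha)%:E)%E.

(* Gamma(kappa); only the values gamma x t with t in [-1, 1] are meaningful. *)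
Definition Gamma_class (R : realType) (kappa : R) (gamma : R -> R -> R) : Prop :=
  [/\ {within [set: R] `*` `[-1, 1], continuous (fun p : R * R => gamma p.1 p.2)},
      forall x : R, gamma x 0 = x
    & exists C1 C2 : R, [/\ 0 < C1, 0 < C2,
      forall x t t' : R, t \in `[-1, 1] -> t' \in `[-1, 1] ->
        `|gamma x t - gamma x t'| <= C1 * `|t - t'| `^ kappa
    & forall t x x' : R, t \in `[-1, 1] ->
        C2^-1 * `|x - x'| <= `|gamma x t - gamma x' t| /\
        `|gamma x t - gamma x' t| <= C2 * `|x - x'| ]].

(* Main.v *)
Require Import Defs.
From HB Require Import structures.
From mathcomp Require Import all_boot all_order all_algebra.
From mathcomp Require Import all_classical all_reals all_analysis.
From mathcomp Require Import measurable_realfun complex.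
From mathcomp Require Import ring lra.
Set Implicit Arguments.
Unset Strict Implicit.
Unset Printing Implicit Defensive.
Import Order.TTheory GRing.Theory Num.Theory.
Import numFieldNormedType.Exports.
Local Open Scope classical_set_scope.
Local Open Scope ring_scope.

(** If the estimate holds for a curve [gamma] and a measure [mu] giving mass at
    least [b^alpha] to [(0, b]], test it on a wave packet with
    [fhat(xi) = (1 + xi^2)^(-s/2) g(xi)], where [g] is a C^2 bump on [[M, M + L]],
    [L <= M]. The Sobolev norm is then the L^2 norm of the inverse Fourier
    transform of [g], of size [L^(1/2)]. If for every [x] in [(0, b]] some time [t]
    keeps the phase [gamma(x,t) xi + t |xi|^m] within distance 1 of a constant on
    [[M, M + L]], there is no cancellation and [|S_t f(gamma(x,t))|] is at least
    [c M^(-s) L]. Hence [L M^(-2s) b^alpha] stays bounded. As [M -> oo] this is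
    contradicted by
    - [gamma(x,t) = x], [L ~ M^(1/2)], [b = 1], [t = - x / (m M^(m-1))]
      when [s < 1/4];
    - [gamma(x,t) = x], [L = M], [b = 1/(2M)], [t = 0] when [s < (1 - alpha)/2];
    - [gamma(x,t) = x - |t|^kappa], [L = M], [b = (2M)^(-m kappa)],
      [t = x^(1/kappa)] when [s < (1 - m alpha kappa)/2].
    That the packet really has the prescribed distributional Fourier transform
    rests on Fourier inversion for C^2 functions of compact support, obtained by
    Abel summation. *)

(** The thresholds are read off [L M^(-2s) b^alpha]: the three choices make it a constant multiple
    of [M^(1/2 - 2s)], [M^(1 - alpha - 2s)] and [M^(1 - m alpha kappa - 2s)], and [s] lies below a
    threshold exactly when the power grows. One measure serves all cases, because mass [b^alpha] on
    [(0, b]] is of the largest order that dimension [alpha] allows. Putting the Bessel weight into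
    [fhat] leaves the unweighted bump as Fourier transform of [(1 - Delta)^(s/2) f], so that its
    norm is controlled by [L] alone. Only an upper bound of order [L^(1/2)] is wanted, and the
    pointwise decay [L / (1 + (L x)^2)], from two integrations by parts, takes the place of
    Plancherel; hence the smoothness C^2. The definitions are distributional, so the Fourier
    transform and the Bessel potential of the packet are checked against Schwartz functions, by the
    multiplication formula and pointwise inversion. The analysis is done on cosine and sine
    transforms of real functions; complex values enter afterwards. *)

(** * Integrals of real functions: integration by parts, compact supports, Fubini *)

Section integral_tools.
Context {R : realType}.
Notation mu := (@lebesgue_measure R).
Implicit Types (F G f g h P A B : R -> R) (a b x : R).

Lemma continuous_integrable_itv f a b : continuous f ->
  mu.-integrable `[a, b] (EFin \o f).
Proof.
move=> cf; apply: continuous_compact_integrable; first exact: segment_compact.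
exact: continuous_subspaceT.
Qed.

Lemma is_derive_continuous F f : (forall x, is_derive x 1 F (f x)) ->
  continuous F.
Proof.
move=> dF x; apply: differentiable_continuous; apply/derivable1_diffP.
exact: (@ex_derive _ _ _ _ _ _ _ (dF x)).
Qed.

Lemma is_derive_LRcontinuous F f a b : (forall x, is_derive x 1 F (f x)) ->
  derivable_oo_LRcontinuous F a b.
Proof.
move=> dF; have cF := is_derive_continuous dF; split.
- by move=> x _; exact: (@ex_derive _ _ _ _ _ _ _ (dF x)).
- by apply: cvg_at_right_filter; exact: cF.
- by apply: cvg_at_left_filter; exact: cF.
Qed.

Lemma is_derive1E F f x : (forall x, is_derive x 1 F (f x)) -> derive1 F x = f x.
Proof. by move=> dF; rewrite derive1E (@derive_val _ _ _ _ _ _ _ (dF x)). Qed.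

Lemma Rintegral_FTC2 F f a b : a < b -> (forall x, is_derive x 1 F (f x)) ->
  continuous f -> \int[mu]_(x in `[a, b]) f x = F b - F a.
Proof.
move=> ab dF cf; rewrite /Rintegral (@continuous_FTC2 _ f F) //.
- by apply: continuous_subspaceT.
- exact: is_derive_LRcontinuous dF.
- by move=> x _; exact: is_derive1E.
Qed.

Lemma Rintegral_by_parts F G f g a b : a < b ->
  (forall x, is_derive x 1 F (f x)) -> (forall x, is_derive x 1 G (g x)) ->
  continuous f -> continuous g ->
  \int[mu]_(x in `[a, b]) (F x * g x) =
  F b * G b - F a * G a - \int[mu]_(x in `[a, b]) (f x * G x).
Proof.
move=> ab dF dG cf cg; apply: Rintegration_by_parts => //;
  try (exact: continuous_subspaceT); try (by apply: is_derive_LRcontinuous; eauto);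
  by move=> x _; exact: is_derive1E.
Qed.

Lemma normr_Rintegral_le f a b (M : R) : a <= b -> continuous f ->
  (forall x, a <= x <= b -> `|f x| <= M) ->
  `|\int[mu]_(x in `[a, b]) f x| <= M * (b - a).
Proof.
move=> ab cf fM.
apply: (le_trans (le_normr_Rintegral _ (continuous_integrable_itv _ _ cf))) => //.
have -> : M * (b - a) = \int[mu]_(x in `[a, b]) M.
  rewrite Rintegral_cst//; congr (_ * _).
  have /= -> := lebesgue_measure_itv `[a, b]; rewrite lte_fin.
  by move: ab; rewrite le_eqVlt => /predU1P[->|->]; rewrite ?ltxx ?subrr //= EFinN.
apply: le_Rintegral => //.
- apply: (continuous_integrable_itv (f := fun x => `|f x|)).
  by move=> x; exact: (continuous_comp (cf x) (@norm_continuous _ _ _)).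
- apply: (continuous_integrable_itv (f := cst M)).
  by move=> x; exact: cst_continuous.
Qed.

Lemma Rintegral_supp F a b : (forall x, ~~ (a < x < b) -> F x = 0) ->
  \int[mu]_x F x = \int[mu]_(x in `[a, b]) F x.
Proof.
move=> F0; rewrite [RHS]Rintegral_mkcond; apply: eq_Rintegral => x _.
rewrite patchE; case: ifPn => //; rewrite notin_setE/= in_itv/= => xab.
by rewrite F0//; apply/negP => /andP[ax xb]; apply: xab; rewrite !ltW.
Qed.

Lemma integrable_supp F a b : continuous F ->
  (forall x, ~~ (a < x < b) -> F x = 0) ->
  mu.-integrable setT (EFin \o F).
Proof.
move=> cF F0; have -> : EFin \o F = ((EFin \o F) \_ `[a, b])%E :> (R -> \bar R).
  apply/funext => x; rewrite patchE; case: ifPn => //=.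
  rewrite notin_setE/= in_itv/= => xab.
  by rewrite F0//; apply/negP => /andP[ax xb]; apply: xab; rewrite !ltW.
by apply/(integrable_mkcond _ _).1 => //; exact: continuous_integrable_itv.
Qed.

Lemma integrable_le_norm D F A : measurable D -> measurable_fun D F ->
  mu.-integrable D (EFin \o A) ->
  (forall x, D x -> `|F x| <= `|A x|) -> mu.-integrable D (EFin \o F).
Proof.
move=> mD mF iA FA; apply: le_integrable iA => //; first exact/measurable_EFinP.
Qed.

Lemma integrable_kernel (G : R * R -> R) B x :
  measurable_fun [set: R * R] G -> (forall z, `|G z| <= 1) ->
  mu.-integrable setT (EFin \o B) ->
  mu.-integrable setT (EFin \o (fun y => G (x, y) * B y)).
Proof.
move=> mG G1 iB.
have mB : measurable_fun setT B.
  by apply/measurable_EFinP; exact: (measurable_int mu iB).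
apply: integrable_le_norm iB _ => //.
  apply: measurable_funM mB.
  exact: measurable_fun_pair2.
by move=> y _; rewrite normrM ler_piMl.
Qed.


(** Since [G] is bounded by 1, the product [A(x) G(x,y) B(y)] is dominated by [|A(x)| |B(y)|], which
    is integrable on the plane. The kernels meant are [cos (x * (y - xi))] for Abel summation, and
    [cos (x * y)], [sin (x * y)] for the multiplication formula. *)
Lemma Fubini_kernel (G : R * R -> R) A B :
  measurable_fun [set: R * R] G -> (forall z, `|G z| <= 1) ->
  mu.-integrable setT (EFin \o A) -> mu.-integrable setT (EFin \o B) ->
  \int[mu]_x (A x * \int[mu]_y (G (x, y) * B y)) =
  \int[mu]_y (B y * \int[mu]_x (G (x, y) * A x)) /\
  mu.-integrable setT (EFin \o (fun x => A x * \int[mu]_y (G (x, y) * B y))).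
Proof.
move=> mG G1 iA iB.
have mA : measurable_fun setT A.
  by apply/measurable_EFinP; exact: (measurable_int mu iA).
have mB : measurable_fun setT B.
  by apply/measurable_EFinP; exact: (measurable_int mu iB).
pose F (z : R * R) := (A z.1 * (G z * B z.2))%:E.
have mF : measurable_fun setT F.
  apply/measurable_EFinP; apply: measurable_funM.
    exact: measurableT_comp mA measurable_fst.
  apply: measurable_funM => //.
  exact: measurableT_comp mB measurable_snd.
have fin1 D : mu.-integrable setT (EFin \o D) ->
    (\int[mu]_x (`|D x|)%:E < +oo)%E.
  by move=> /integrableP[].
have iF : (mu \x mu)%E.-integrable setT F.
  apply/integrable12ltyP => //.
  pose bB := (\int[mu]_y (`|B y|)%:E)%E.
  have bB0 : (0 <= bB)%E by apply: integral_ge0.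
  have bBfin : bB \is a fin_num by rewrite ge0_fin_numE// fin1.
  apply: (@le_lt_trans _ _ (\int[mu]_x ((`|A x|)%:E * bB))%E).
    apply: ge0_le_integral => //.
    - by move=> x _; exact: integral_ge0.
    - have mF' : measurable_fun setT (abse \o F) by exact: measurableT_comp.
      have F0 z : (0 <= (abse \o F) z)%E by exact: abse_ge0.
      have H := @measurable_fun_fubini_tonelli_F _ _ (measurableTypeR R)
        (measurableTypeR R) R mu _ mF' F0.
      exact H.
    - apply: emeasurable_funM => //; apply/measurable_EFinP.
      exact: measurableT_comp.
    - move=> x _; rewrite /bB -ge0_integralZl//; last first.
        by apply/measurable_EFinP; exact: measurableT_comp.
      apply: ge0_le_integral => //.
      + by apply: measurableT_comp => //; exact: measurable_fun_pair2.
      + apply: emeasurable_funM => //; apply/measurable_EFinP.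
        exact: measurableT_comp.
      + move=> y _; rewrite /F /= lee_fin !normrM ler_wpM2l//.
        by rewrite ler_piMl.
  rewrite -(fineK bBfin) ge0_integralZr//; last 2 first.
  - by apply/measurable_EFinP; exact: measurableT_comp.
  - by rewrite lee_fin fine_ge0.
  by rewrite lte_mul_pinfty// ?integral_ge0 ?ltry// ?ge0_fin_numE ?integral_ge0 ?fin1.
have Fx x : (\int[mu]_y F (x, y))%E = (A x * \int[mu]_y (G (x, y) * B y))%:E.
  have iGB := integrable_kernel x mG G1 iB.
  rewrite EFinM fineK; last exact: integrable_fin_num.
  by rewrite -integralZl//; apply: eq_integral => y _; rewrite /F /= EFinM.
have Fy y : (\int[mu]_x F (x, y))%E = (B y * \int[mu]_x (G (x, y) * A x))%:E.
  have iGA : mu.-integrable setT (EFin \o (fun x => G (x, y) * A x)).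
    apply: (@integrable_kernel (fun z => G (z.2, z.1)) A y) => //.
    apply: (measurableT_comp mG).
    by apply: measurable_fun_pair; [exact: measurable_snd|exact: measurable_fst].
  rewrite EFinM fineK; last exact: integrable_fin_num.
  rewrite -integralZl//; apply: eq_integral => x _.
  by rewrite /F /= -EFinM; congr EFin; ring.
split; last first.
  have := integrable_fubini_F iF; apply: eq_integrable => // x _.
  exact: Fx.
rewrite /Rintegral; congr fine.
under eq_integral do rewrite -Fx.
by rewrite (Fubini iF); apply: eq_integral => y _; rewrite Fy.
Qed.

End integral_tools.

(** * Rules of calculus, dominated convergence, reflection at the origin, the arctangent integral *)

Section calculus_and_limits.
Context {R : realType}.
Notation mu := (@lebesgue_measure R).
Implicit Types (F G f g h P A B : R -> R) (a b x L : R).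

Lemma is_derive_mul F G (df dg : R) x : is_derive x 1 F df -> is_derive x 1 G dg ->
  is_derive x 1 (fun z => F z * G z) (df * G x + F x * dg).
Proof.
move=> dF dG; apply: (is_derive_eq (is_deriveM dF dG)).
by rewrite /GRing.scale /= addrC mulrC.
Qed.

Lemma is_derive_add F G (df dg : R) x : is_derive x 1 F df -> is_derive x 1 G dg ->
  is_derive x 1 (fun z => F z + G z) (df + dg).
Proof. by move=> dF dG; exact: is_deriveD. Qed.

Lemma is_derive_comp F G (df dg : R) x : is_derive (G x) 1 F df ->
  is_derive x 1 G dg -> is_derive x 1 (fun z => F (G z)) (df * dg).
Proof. by move=> dF dG; exact: (is_derive1_comp dF dG). Qed.

Lemma is_derive_cst x (c : R) : is_derive x 1 (fun _ : R => c) 0.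
Proof. exact: is_derive_cst. Qed.

(** Inner functions of all later chain rules are brought to this shape, which is where the summands
    [+ 0] in the primitives below come from. *)
Lemma is_derive_affine x (c d : R) : is_derive x 1 (fun z : R => c * z + d) c.
Proof.
have H := is_derive_add (is_derive_mul (is_derive_cst x c) (is_derive_id x 1))
  (is_derive_cst x d).
by apply: (is_derive_eq H); ring.
Qed.

Lemma continuous_affine (c d : R) : continuous (fun z : R => c * z + d).
Proof. exact: is_derive_continuous (fun x => is_derive_affine x c d). Qed.

Lemma continuous_mulf f g : continuous f -> continuous g ->
  continuous (fun x => f x * g x).
Proof. by move=> cf cg x; apply: continuousM; [exact: cf|exact: cg]. Qed.

Lemma continuous_addf f g : continuous f -> continuous g ->
  continuous (fun x => f x + g x).
Proof. by move=> cf cg x; apply: continuousD; [exact: cf|exact: cg]. Qed.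

Lemma continuous_compf f g : continuous f -> continuous g ->
  continuous (fun x => g (f x)).
Proof. by move=> cf cg x; apply: continuous_comp; [exact: cf|exact: cg]. Qed.

Lemma continuous_invf f : continuous f -> (forall x, f x != 0) ->
  continuous (fun x => (f x)^-1).
Proof. by move=> cf f0 x; apply: cvgV; [exact: f0|exact: cf]. Qed.

Lemma continuous_oneDsqrM L : continuous (fun x => 1 + (L * x) ^+ 2).
Proof.
have cL : continuous (fun x => L * x).
  by move=> x; apply: cvgMr; exact: cvg_id.
apply: continuous_addf; first by move=> x; exact: cst_continuous.
exact: continuous_mulf.
Qed.

Lemma Rintegral_dominated_cvg (D : set R) (f_ : nat -> R -> R) f g :
  measurable D -> (forall n, measurable_fun D (f_ n)) ->
  (forall x, D x -> f_ n x @[n --> \oo] --> f x) ->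
  mu.-integrable D (EFin \o g) ->
  (forall n x, D x -> `|f_ n x| <= g x) ->
  \int[mu]_(x in D) f_ n x @[n --> \oo] --> \int[mu]_(x in D) f x.
Proof.
move=> mD mf cf ig fg.
have mf' n : measurable_fun D (EFin \o f_ n) by exact/measurable_EFinP.
have cf' x : D x -> (EFin \o f_ n) x @[n --> \oo] --> (EFin \o f) x.
  by move=> Dx; apply: cvg_EFin; [exact: nearW|exact: cf].
have fg' n x : D x -> (`|(EFin \o f_ n) x| <= (EFin \o g) x)%E.
  by move=> Dx; rewrite /= lee_fin; exact: fg.
have mfl : measurable_fun D (EFin \o f).
  exact: (emeasurable_fun_cvg (fun n => EFin \o f_ n)).
have := @dominated_convergence _ _ _ mu D mD (fun n => EFin \o f_ n) (EFin \o f)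
  (EFin \o g) mf' mfl.
case=> //; [exact: aeW|by apply: aeW => x n; exact: fg'|move=> ifi _].
have -> : (\int[mu]_(x in D) (EFin \o f) x)%E = (\int[mu]_(x in D) f x)%:E.
  by rewrite fineK//; exact: integrable_fin_num.
by move=> /fine_cvg.
Qed.

Lemma Rintegral_reflect_ge0 g : continuous g -> (forall x, 0 <= g x) ->
  (\int[mu]_(x in `]-oo, 0%R]) (g x)%:E = \int[mu]_(x in `[0%R, +oo[) (g (- x))%:E)%E.
Proof.
move=> cg g0; rewrite -{1}oppr0 ge0_integration_by_substitutionNy//.
exact: continuous_subspaceT.
Qed.

Lemma integrable_reflect h : continuous h ->
  mu.-integrable setT (EFin \o h) ->
  mu.-integrable `[0, +oo[ (EFin \o (fun x => h (- x))).
Proof.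
move=> ch ih; have cN : continuous (fun x => h (- x)).
  by apply: continuous_compf => //; exact: opp_continuous.
apply/integrableP; split.
  by apply/measurable_EFinP; apply: measurable_funTS; exact: continuous_measurable_fun.
have := Rintegral_reflect_ge0 (g := fun x => `|h x|).
rewrite /= => <-//; last first.
  by apply: continuous_compf => //; exact: norm_continuous.
have i2 : mu.-integrable `]-oo, 0%R] (EFin \o h) by apply: integrableS ih.
by case/integrableP: i2.
Qed.

(** Substitution is available for nonnegative functions; it is applied to [|h| + h] and to [|h|],
    whose difference is [h]. *)
Lemma Rintegral_reflect h : continuous h -> mu.-integrable setT (EFin \o h) ->
  \int[mu]_(x in `]-oo, 0]) h x = \int[mu]_(x in `[0, +oo[) h (- x).
Proof.
move=> ch ih.
have cn : continuous (fun x => `|h x|).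
  by apply: continuous_compf => //; exact: norm_continuous.
have inn : mu.-integrable setT (EFin \o (fun x => `|h x|)).
  have := integrable_abse ih; apply: eq_integrable => // x _.
have cs : continuous (fun x => `|h x| + h x) by exact: continuous_addf.
have iS : mu.-integrable setT (EFin \o (fun x => `|h x| + h x)).
  have := integrableD measurableT inn ih; apply: eq_integrable => // x _.
have hE (x : R) : h x = (`|h x| + h x) - `|h x| by ring.
have ge0s x : 0 <= `|h x| + h x by rewrite -lerBlDr sub0r ler_normr lexx orbT.
have S D : measurable D -> forall f, mu.-integrable setT (EFin \o f) ->
    mu.-integrable D (EFin \o f).
  by move=> mD f; apply: integrableS.
under eq_Rintegral do rewrite hE.
under [RHS]eq_Rintegral do rewrite hE.
rewrite !RintegralB//; try exact: S;
  [|exact: (integrable_reflect cs iS)|exact: (integrable_reflect cn inn)].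
congr (_ - _).
- by rewrite /Rintegral (Rintegral_reflect_ge0 cs).
- by rewrite /Rintegral (Rintegral_reflect_ge0 cn).
Qed.

Lemma Rintegral_fold h : continuous h -> mu.-integrable setT (EFin \o h) ->
  \int[mu]_x h x = \int[mu]_(x in `[0, +oo[) (h x + h (- x)).
Proof.
move=> ch ih.
have S D : measurable D -> mu.-integrable D (EFin \o h).
  by move=> mD; apply: integrableS ih.
rewrite RintegralD//; [|exact: S|exact: integrable_reflect].
rewrite -Rintegral_reflect// addrC.
have <- : `]-oo, 0%R[%classic `|` `[0%R, +oo[%classic = [set: R].
  by rewrite -[in X in _ `|` X]setCitvl setUv.
rewrite Rintegral_setU//.
- by congr (_ + _); apply: Rintegral_itv_bndo_bndc; exact: S.
- by apply: (integrableS _ _ _ ih) => //; exact: measurableU.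
- apply/disj_set2P; rewrite -subset0 => x [/=]; rewrite !in_itv/= andbT.
  by move=> /lt_le_trans h0 /h0; rewrite ltxx.
Qed.

(** The factor [1 / L] is what turns the bound [L^2 / (1 + (L x)^2)] on the squared packet into an
    integral of order [L]. *)
Lemma integral_oneDsqrV L : 0 < L ->
  (\int[mu]_x ((1 + (L * x) ^+ 2)^-1)%:E = (pi / L)%:E)%E.
Proof.
move=> L0.
have D0 x : 0 < 1 + (L * x) ^+ 2 by rewrite ltr_pwDl// sqr_ge0.
have cf : continuous (fun x => (1 + (L * x) ^+ 2)^-1).
  by apply: continuous_invf => x; [exact: continuous_oneDsqrM|rewrite gt_eqF].
have dF x : is_derive x 1 (fun z => L^-1 * atan (L * z + 0)) ((1 + (L * x) ^+ 2)^-1).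
  have H := is_derive_mul (is_derive_cst x L^-1)
    (is_derive_comp (is_derive1_atan _) (is_derive_affine x L 0)).
  by apply: (is_derive_eq H); rewrite addr0; field; rewrite !gt_eqF.
rewrite ge0_symfun_integralT//; last 2 first.
- by move=> x; rewrite invr_ge0 ltW.
- by move=> x /=; rewrite mulrN sqrrN.
rewrite -set_itvcy (@ge0_continuous_FTC2y _ _ (fun z => L^-1 * atan (L * z + 0)) _
  (L^-1 * (pi / 2))).
- by rewrite mulr0 addr0 atan0 mulr0 sube0 -EFinM; congr EFin; field; rewrite gt_eqF.
- by move=> x _; rewrite invr_ge0 ltW.
- exact: continuous_subspaceT.
- apply: cvgMr.
  have cL : L * x + 0 @[x --> +oo] --> +oo.
    by under eq_fun do rewrite addr0; apply: gt0_cvgMry => //; exact: cvg_id.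
  have H := @cvg_comp _ _ _ (fun x => L * x + 0) (@atan R) _ _ _ cL (@cvgy_atan R).
  exact: H.
- by move=> x _; exact: (@ex_derive _ _ _ _ _ _ _ (dF x)).
- by apply: cvg_at_right_filter; exact: (is_derive_continuous dF).
- by move=> x _; exact: is_derive1E.
Qed.

Lemma integrable_oneDsqrV L : 0 < L ->
  mu.-integrable setT (EFin \o (fun x => (1 + (L * x) ^+ 2)^-1)).
Proof.
move=> L0.
have D0 x : 0 < 1 + (L * x) ^+ 2 by rewrite ltr_pwDl// sqr_ge0.
have cf : continuous (fun x => (1 + (L * x) ^+ 2)^-1).
  by apply: continuous_invf => x; [exact: continuous_oneDsqrM|rewrite gt_eqF].
apply/integrableP; split.
  by apply/measurable_EFinP; exact: continuous_measurable_fun.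
rewrite (_ : (\int[mu]_x _)%E = (pi / L)%:E) ?ltry// -integral_oneDsqrV//.
by apply: eq_integral => x _ /=; rewrite ger0_norm// invr_ge0 ltW.
Qed.

End calculus_and_limits.

(** * Cosine and sine transforms and their quadratic decay *)

Definition supported (R : realType) (a b : R) (P : R -> R) : Prop :=
  forall x, ~~ (a < x < b) -> P x = 0.

(** For real [P], this and [sin_transform] are the real and imaginary parts of the integral of
    [e^(i x y) P(y)] in [y], the inverse Fourier transform up to [2 pi]. *)
Definition cos_transform (R : realType) (P : R -> R) (x : R) : R :=
  \int[@lebesgue_measure R]_y (cos (x * y) * P y).

Definition sin_transform (R : realType) (P : R -> R) (x : R) : R :=
  \int[@lebesgue_measure R]_y (sin (x * y) * P y).

Section transforms.
Context {R : realType}.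
Notation mu := (@lebesgue_measure R).
Implicit Types (P Q g : R -> R) (a b x L M : R).

Lemma normr_cos_le1 (x : R) : `|cos x| <= 1.
Proof. by rewrite ler_norml cos_geN1 cos_le1. Qed.

Lemma normr_sin_le1 (x : R) : `|sin x| <= 1.
Proof. by rewrite ler_norml sin_geN1 sin_le1. Qed.

Lemma continuous_kernel g x : continuous g -> continuous (fun y => g (x * y)).
Proof.
by move=> cg; apply: continuous_compf => // y; apply: cvgMr; exact: cvg_id.
Qed.

Lemma continuous_kernel_transform g Q : continuous g -> (forall x, `|g x| <= 1) ->
  continuous Q -> mu.-integrable setT (EFin \o Q) ->
  continuous (fun x => \int[mu]_y (g (x * y) * Q y)).
Proof.
move=> cg g1 cQ iQ x; apply/(@cvg_nbhsP _ R^o) => w wx.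
apply: (@Rintegral_dominated_cvg R setT (fun n y => g (w n * y) * Q y) _ (fun y => `|Q y|)).
- exact: measurableT.
- move=> n; apply: continuous_measurable_fun; apply: continuous_mulf => //.
  exact: continuous_kernel.
- move=> y _; apply: cvgMl; apply: continuous_cvg; first exact: cg.
  exact: cvgMl.
- by have := integrable_abse iQ; apply: eq_integrable.
- by move=> n y _; rewrite normrM ler_piMl.
Qed.

Lemma continuous_cos_transform Q : continuous Q ->
  mu.-integrable setT (EFin \o Q) -> continuous (cos_transform Q).
Proof.
by apply: continuous_kernel_transform; [exact: continuous_cos|exact: normr_cos_le1].
Qed.

Lemma continuous_sin_transform Q : continuous Q ->
  mu.-integrable setT (EFin \o Q) -> continuous (sin_transform Q).
Proof.
by apply: continuous_kernel_transform; [exact: continuous_sin|exact: normr_sin_le1].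
Qed.

Lemma cos_transformN Q x : cos_transform Q (- x) = cos_transform Q x.
Proof. by apply: eq_Rintegral => y _; rewrite mulNr cosN. Qed.

Lemma sin_transformN Q x : mu.-integrable setT (EFin \o Q) -> continuous Q ->
  sin_transform Q (- x) = - sin_transform Q x.
Proof.
move=> iQ cQ; rewrite -[RHS]mulN1r -RintegralZl//.
  by apply: eq_Rintegral => y _; rewrite mulNr sinN; ring.
apply: integrable_le_norm iQ _ => //.
  apply: continuous_measurable_fun; apply: continuous_mulf => //.
  by apply: continuous_kernel; exact: continuous_sin.
by move=> y _; rewrite normrM ler_piMl// normr_sin_le1.
Qed.

Lemma transform_bound g Q a b x M : a <= b -> supported a b Q -> continuous Q ->
  continuous g -> (forall x, `|g x| <= 1) -> (forall y, `|Q y| <= M) ->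
  `|\int[mu]_y (g (x * y) * Q y)| <= M * (b - a).
Proof.
move=> ab sQ cQ cg g1 QM.
rewrite (@Rintegral_supp _ _ a b) => [|y /sQ ->]; last by rewrite mulr0.
apply: normr_Rintegral_le => //.
  by apply: continuous_mulf => //; exact: continuous_kernel.
by move=> y _; apply: le_trans (QM y); rewrite normrM ler_piMl.
Qed.

Lemma supported_ends a b Q : supported a b Q -> Q a = 0 /\ Q b = 0.
Proof. by move=> sQ; split; apply: sQ; rewrite ltxx ?andbF. Qed.

Lemma is_derive_sinM x (y : R) :
  is_derive y 1 (fun z : R => sin (x * z + 0)) (x * cos (x * y)).
Proof.
have H := is_derive_comp (is_derive_sin _) (is_derive_affine y x 0).
by apply: (is_derive_eq H); rewrite addr0 mulrC.
Qed.

Lemma is_derive_cosM x (y : R) :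
  is_derive y 1 (fun z : R => - cos (x * z + 0)) (x * sin (x * y)).
Proof.
have H := is_derive_mul (is_derive_cst y (-1))
  (is_derive_comp (is_derive_cos _) (is_derive_affine y x 0)).
have -> : (fun z : R => - cos (x * z + 0)) = (fun z => -1 * cos (x * z + 0)).
  by apply/funext => z; rewrite mulN1r.
by apply: (is_derive_eq H); rewrite addr0; ring.
Qed.

(** Integration by parts, with boundary terms killed by the support. Together with its sine
    counterpart it shows that [x^2] times a transform of [P] is minus the same transform of the
    second derivative. *)
Lemma cos_transform_deriv P P1 a b x : a < b ->
  (forall x, is_derive x 1 P (P1 x)) -> continuous P1 ->
  supported a b P -> supported a b P1 ->
  x * cos_transform P x = - sin_transform P1 x.
Proof.
move=> ab dP cP1 sP sP1; have cP := is_derive_continuous dP.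
have [Pa Pb] := supported_ends sP.
have ccos : continuous (fun y => cos (x * y)).
  by apply: continuous_kernel; exact: continuous_cos.
rewrite /cos_transform /sin_transform.
rewrite (@Rintegral_supp _ _ a b) => [|y /sP ->]; last by rewrite mulr0.
rewrite (@Rintegral_supp _ _ a b) => [|y /sP1 ->]; last by rewrite mulr0.
rewrite -RintegralZl//; last first.
  by apply: continuous_integrable_itv; exact: continuous_mulf.
have := Rintegral_by_parts ab dP (is_derive_sinM x) cP1.
rewrite Pa Pb !mul0r subrr sub0r => H.
transitivity (\int[mu]_(y in `[a, b]) (P y * (x * cos (x * y)))).
  by apply: eq_Rintegral => y _; ring.
rewrite H; last first.
  by apply: continuous_mulf => //; move=> y; exact: cst_continuous.
by congr (- _); apply: eq_Rintegral => y _; rewrite addr0 mulrC.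
Qed.

Lemma sin_transform_deriv P P1 a b x : a < b ->
  (forall x, is_derive x 1 P (P1 x)) -> continuous P1 ->
  supported a b P -> supported a b P1 ->
  x * sin_transform P x = cos_transform P1 x.
Proof.
move=> ab dP cP1 sP sP1; have cP := is_derive_continuous dP.
have [Pa Pb] := supported_ends sP.
have csin : continuous (fun y => sin (x * y)).
  by apply: continuous_kernel; exact: continuous_sin.
rewrite /cos_transform /sin_transform.
rewrite (@Rintegral_supp _ _ a b) => [|y /sP ->]; last by rewrite mulr0.
rewrite (@Rintegral_supp _ _ a b) => [|y /sP1 ->]; last by rewrite mulr0.
rewrite -RintegralZl//; last first.
  by apply: continuous_integrable_itv; exact: continuous_mulf.
have := Rintegral_by_parts ab dP (is_derive_cosM x) cP1.
rewrite Pa Pb !mul0r subrr sub0r => H.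
transitivity (\int[mu]_(y in `[a, b]) (P y * (x * sin (x * y)))).
  by apply: eq_Rintegral => y _; ring.
rewrite H; last first.
  by apply: continuous_mulf => //; move=> y; exact: cst_continuous.
have ccos : continuous (fun y => cos (x * y)).
  by apply: continuous_kernel; exact: continuous_cos.
rewrite -mulN1r -RintegralZl//; last first.
  apply: continuous_integrable_itv; apply: continuous_mulf => //.
  by move=> y; apply: is_derive_continuous (is_derive_cosM x) _.
by apply: eq_Rintegral => y _; rewrite addr0; ring.
Qed.

(** Both [|v|] and [L^2 x^2 |v|] are at most [M D]; adding the two bounds gives the factor 2. Here
    [v] stands for a transform, [w] for that of the second derivative, [D] for the length of the
    support. *)
Lemma decay_of_bounds (L M D v w x : R) : 0 < L -> 0 <= D ->
  `|v| <= M * D -> x ^+ 2 * v = - w -> `|w| <= M / L ^+ 2 * D ->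
  `|v| <= 2 * M * D / (1 + (L * x) ^+ 2).
Proof.
move=> L0 D0 vM vw wM.
rewrite ler_pdivlMr; last by rewrite ltr_pwDl// sqr_ge0.
have wE : `|x ^+ 2 * v| <= M / L ^+ 2 * D by rewrite vw normrN.
rewrite normrM ger0_norm ?sqr_ge0// in wE.
have : L ^+ 2 * (x ^+ 2 * `|v|) <= M * D.
  rewrite mulrC -ler_pdivlMr ?exprn_gt0//.
  by rewrite (le_trans wE)// mulrAC.
have -> : `|v| * (1 + (L * x) ^+ 2) = `|v| + L ^+ 2 * (x ^+ 2 * `|v|) by ring.
lra.
Qed.

(** The scale [L] is left free: [L = 1] gives integrability for every C^2 function of compact
    support, while [L = b - a] gives the sharp profile of the bump. *)
Lemma cos_transform_decay P P1 P2 a b L M x : a < b -> 0 < L ->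
  (forall x, is_derive x 1 P (P1 x)) -> (forall x, is_derive x 1 P1 (P2 x)) ->
  continuous P2 -> supported a b P -> supported a b P1 -> supported a b P2 ->
  (forall y, `|P y| <= M) -> (forall y, `|P2 y| <= M / L ^+ 2) ->
  `|cos_transform P x| <= 2 * M * (b - a) / (1 + (L * x) ^+ 2).
Proof.
move=> ab L0 dP dP1 cP2 sP sP1 sP2 PM P2M.
apply: (@decay_of_bounds _ _ _ _ (cos_transform P2 x)) => //.
- by rewrite subr_ge0 ltW.
- apply: transform_bound => //; try exact: ltW; try exact: is_derive_continuous dP.
  exact: continuous_cos.
  exact: normr_cos_le1.
- rewrite expr2 -mulrA (cos_transform_deriv _ ab dP) //; last first.
    exact: is_derive_continuous dP1.
  by rewrite mulrN (sin_transform_deriv _ ab dP1).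
- apply: transform_bound => //; try exact: ltW.
  exact: continuous_cos.
  exact: normr_cos_le1.
Qed.

Lemma sin_transform_decay P P1 P2 a b L M x : a < b -> 0 < L ->
  (forall x, is_derive x 1 P (P1 x)) -> (forall x, is_derive x 1 P1 (P2 x)) ->
  continuous P2 -> supported a b P -> supported a b P1 -> supported a b P2 ->
  (forall y, `|P y| <= M) -> (forall y, `|P2 y| <= M / L ^+ 2) ->
  `|sin_transform P x| <= 2 * M * (b - a) / (1 + (L * x) ^+ 2).
Proof.
move=> ab L0 dP dP1 cP2 sP sP1 sP2 PM P2M.
apply: (@decay_of_bounds _ _ _ _ (sin_transform P2 x)) => //.
- by rewrite subr_ge0 ltW.
- apply: transform_bound => //; try exact: ltW; try exact: is_derive_continuous dP.
  exact: continuous_sin.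
  exact: normr_sin_le1.
- rewrite expr2 -mulrA (sin_transform_deriv _ ab dP) //; last first.
    exact: is_derive_continuous dP1.
  by rewrite (cos_transform_deriv _ ab dP1).
- apply: transform_bound => //; try exact: ltW.
  exact: continuous_sin.
  exact: normr_sin_le1.
Qed.

End transforms.

(** * The Poisson kernel as an approximate identity *)

Section poisson_kernel.
Context {R : realType}.
Notation mu := (@lebesgue_measure R).
Implicit Types (P Q g h : R -> R) (a b x y xi e n M : R).

(** The term [e / (e^2 + y^2)] is the Poisson kernel; the rest, which carries [exp(- e n)], is the
    error of cutting the integral at [n]. *)
Lemma abel_kernel e n y : 0 < e -> 0 < n ->
  \int[mu]_(x in `[0, n]) (cos (x * y) * expR (- e * x + 0)) =
  (e - expR (- e * n) * (e * cos (n * y) - y * sin (n * y))) / (e ^+ 2 + y ^+ 2).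
Proof.
move=> e0 n0.
have D0 : e ^+ 2 + y ^+ 2 != 0 by rewrite gt_eqF// ltr_pwDl ?sqr_ge0// exprn_gt0.
(* The real part of [e^((- e + i y) x) / (- e + i y)]. *)
pose F (x : R) := expR (- e * x + 0) *
  ((e ^+ 2 + y ^+ 2)^-1 * (y * sin (y * x + 0) + (- e) * cos (y * x + 0))).
have dE (x : R) : is_derive x 1 (fun x => expR (- e * x + 0)) (expR (- e * x + 0) * - e).
  exact: (is_derive_comp (is_derive_expR _) (is_derive_affine x (- e) 0)).
have ds (x : R) := is_derive_comp (is_derive_sin _) (is_derive_affine x y 0).
have dc (x : R) := is_derive_comp (is_derive_cos _) (is_derive_affine x y 0).
have dF x : is_derive x 1 F (cos (x * y) * expR (- e * x + 0)).
  have H := is_derive_mul (dE x) (is_derive_mul (is_derive_cst x (e ^+ 2 + y ^+ 2)^-1)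
    (is_derive_add (is_derive_mul (is_derive_cst x y) (ds x))
                   (is_derive_mul (is_derive_cst x (- e)) (dc x)))).
  by apply: (is_derive_eq H); rewrite (mulrC x y) !addr0; field.
rewrite (@Rintegral_FTC2 _ F)//.
  rewrite /F !mulr0 !addr0 expR0 sin0 cos0 (mulrC n y).
  by field.
apply: continuous_mulf; last exact: is_derive_continuous dE.
have := @continuous_kernel _ cos y (@continuous_cos R).
by under eq_fun do rewrite mulrC.
Qed.

(** The damping parameter runs through a sequence, so that dominated convergence for sequences
    applies to all limits below. *)
Definition harm (k : nat) : R := k.+1%:R^-1.

Lemma harm_gt0 k : 0 < harm k. Proof. by rewrite invr_gt0 ltr0n. Qed.

Lemma cvg_harm : harm k @[k --> \oo] --> (0 : R).
Proof. exact: cvg_harmonic. Qed.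

Lemma cvgy_succn : k.+1%:R @[k --> \oo] --> (+oo : set_system R).
Proof. by rewrite (cvg_shiftS (fun k => k%:R : R)); exact: cvgr_idn. Qed.

Lemma cvg_atan_pos (t : R) : 0 < t ->
  atan ((harm k)^-1 * t) @[k --> \oo] --> (pi / 2 : R).
Proof.
move=> t0.
have c2 : z * t @[z --> +oo] --> (+oo : set_system R).
  by apply: gt0_cvgMly => //; exact: cvg_id.
have c3 := @cvg_comp _ _ _ (fun z : R => z * t) (@atan R) _ _ _ c2 (@cvgy_atan R).
have H := @cvg_comp _ _ _ (fun k => k.+1%:R : R) _ _ _ _ cvgy_succn c3.
by under eq_fun do rewrite invrK; exact: H.
Qed.

Lemma cvg_atan_neg (t : R) : t < 0 ->
  atan ((harm k)^-1 * t) @[k --> \oo] --> (- (pi / 2) : R).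
Proof.
move=> t0; have := @cvg_atan_pos (- t); rewrite oppr_gt0 => /(_ t0) H.
have -> : (fun k => atan ((harm k)^-1 * t)) = (fun k => - atan ((harm k)^-1 * - t)).
  by apply/funext => k; rewrite -atanN mulrN opprK.
exact: cvgN.
Qed.

Lemma normr_atan_le (t : R) : `|atan t| <= pi / 2.
Proof. by rewrite ler_norml !ltW ?atan_gtNpi2 ?atan_ltpi2. Qed.

Lemma subset_itvco_cc a b : `[a, b[ `<=` `[a, b].
Proof. by move=> x /=; rewrite !in_itv/= => /andP[-> /ltW ->]. Qed.

Lemma subset_itvoc_cc a b : `]a, b] `<=` `[a, b].
Proof. by move=> x /=; rewrite !in_itv/= => /andP[/ltW -> ->]. Qed.

(* By parts the Poisson kernel becomes an arctangent, which tends to a step at [xi]. *)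
Lemma cvg_poisson P P1 a b xi : a < xi < b ->
  (forall x, is_derive x 1 P (P1 x)) -> continuous P1 -> supported a b P ->
  \int[mu]_y (P y * (harm k / (harm k ^+ 2 + (y - xi) ^+ 2))) @[k --> \oo]
    --> pi * P xi.
Proof.
move=> /andP[axi xib] dP cP1 sP.
have ab := lt_trans axi xib.
have [Pa Pb] := supported_ends sP.
pose G k (y : R) := atan ((harm k)^-1 * y + - ((harm k)^-1 * xi)).
have GE k y : G k y = atan ((harm k)^-1 * (y - xi)) by rewrite /G mulrBr.
pose g k (y : R) := harm k / (harm k ^+ 2 + (y - xi) ^+ 2).
have D0 k y : 0 < harm k ^+ 2 + (y - xi) ^+ 2.
  by rewrite ltr_pwDl ?sqr_ge0// exprn_gt0 ?harm_gt0.
have dG k y : is_derive y 1 (G k) (g k y).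
  have H := is_derive_comp (is_derive1_atan _)
    (is_derive_affine y (harm k)^-1 (- ((harm k)^-1 * xi))).
  apply: (is_derive_eq H); rewrite /g.
  have h0 := harm_gt0 k; have h1 := D0 k y.
  have h2 : 0 < 1 + ((harm k)^-1 * y - (harm k)^-1 * xi) ^+ 2.
    by rewrite ltr_pwDl ?sqr_ge0.
  move: h0 h1 h2; set t := harm k => h0 h1 h2.
  have -> : 1 + (t^-1 * y - t^-1 * xi) ^+ 2 = (t ^+ 2 + (y - xi) ^+ 2) / t ^+ 2.
    by field; rewrite gt_eqF.
  by field; rewrite !gt_eqF.
have cg k : continuous (g k).
  apply: continuous_mulf; first by move=> y; exact: cst_continuous.
  apply: continuous_invf => [|y]; last by rewrite gt_eqF.
  apply: continuous_addf; first by move=> y; exact: cst_continuous.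
  have cB : continuous (fun y => y - xi).
    apply: continuous_addf => // y; first exact: cvg_id.
    exact: cst_continuous.
  exact: continuous_mulf.
have cG k : continuous (G k) by exact: is_derive_continuous (dG k).
(* The point [xi] is left out of both pieces: there [G k] is 0 for every [k], whereas it tends to
   [- pi / 2] on the left and to [pi / 2] on the right. Each piece then tends to [- (pi / 2) P(xi)],
   as [P] vanishes at [a] and [b]. *)
have step k : \int[mu]_y (P y * (harm k / (harm k ^+ 2 + (y - xi) ^+ 2))) =
   - (\int[mu]_(y in `[a, xi[) (P1 y * G k y) +
      \int[mu]_(y in `]xi, b]) (P1 y * G k y)).
  rewrite (@Rintegral_supp _ _ a b) => [|y /sP ->]; last by rewrite mul0r.
  rewrite (Rintegral_by_parts ab dP (dG k) cP1 (cg k)) Pa Pb !mul0r subrr sub0r.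
  have iab := continuous_integrable_itv a b (continuous_mulf cP1 (cG k)).
  have iaxi := continuous_integrable_itv a xi (continuous_mulf cP1 (cG k)).
  congr (- _); rewrite -(Rintegral_itvB (x := xi) iab) ?bnd_simp ?ltW//.
  rewrite Rintegral_itv_bndo_bndc; first by ring.
  by apply: integrableS iaxi => //; exact: subset_itvco_cc.
have lim1 : \int[mu]_(y in `[a, xi[) (P1 y * G k y) @[k --> \oo] -->
    \int[mu]_(y in `[a, xi[) (P1 y * - (pi / 2)).
  apply: (@Rintegral_dominated_cvg _ _ _ _ (fun y => `|P1 y| * (pi / 2))) => //.
  - move=> k; apply: measurable_funTS; apply: continuous_measurable_fun.
    exact: continuous_mulf.
  - move=> y /=; rewrite in_itv/= => /andP[_ yxi].
    apply: cvgMr; under eq_fun do rewrite GE.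
    by apply: cvg_atan_neg; rewrite subr_lt0.
  - have cA : continuous (fun y => `|P1 y| * (pi / 2)).
      apply: continuous_mulf; last by move=> y; exact: cst_continuous.
      by apply: continuous_compf => //; exact: norm_continuous.
    apply: integrableS (continuous_integrable_itv a xi cA) => //.
    exact: subset_itvco_cc.
  - by move=> k y _; rewrite normrM ler_wpM2l// normr_atan_le.
have lim2 : \int[mu]_(y in `]xi, b]) (P1 y * G k y) @[k --> \oo] -->
    \int[mu]_(y in `]xi, b]) (P1 y * (pi / 2)).
  apply: (@Rintegral_dominated_cvg _ _ _ _ (fun y => `|P1 y| * (pi / 2))) => //.
  - move=> k; apply: measurable_funTS; apply: continuous_measurable_fun.
    exact: continuous_mulf.
  - move=> y /=; rewrite in_itv/= => /andP[xiy _].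
    apply: cvgMr; under eq_fun do rewrite GE.
    by apply: cvg_atan_pos; rewrite subr_gt0.
  - have cA : continuous (fun y => `|P1 y| * (pi / 2)).
      apply: continuous_mulf; last by move=> y; exact: cst_continuous.
      by apply: continuous_compf => //; exact: norm_continuous.
    apply: integrableS (continuous_integrable_itv xi b cA) => //.
    exact: subset_itvoc_cc.
  - by move=> k y _; rewrite normrM ler_wpM2l// normr_atan_le.
have i1 := continuous_integrable_itv a xi cP1.
have i2 := continuous_integrable_itv xi b cP1.
have i1' : mu.-integrable `[a, xi[ (EFin \o P1).
  by apply: integrableS i1 => //; exact: subset_itvco_cc.
have i2' : mu.-integrable `]xi, b] (EFin \o P1).
  by apply: integrableS i2 => //; exact: subset_itvoc_cc.
have E1 : \int[mu]_(y in `[a, xi[) (P1 y * - (pi / 2)) = - (pi / 2) * P xi.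
  rewrite RintegralZr// Rintegral_itv_bndo_bndc//.
  by rewrite (Rintegral_FTC2 axi dP cP1) Pa; ring.
have E2 : \int[mu]_(y in `]xi, b]) (P1 y * (pi / 2)) = - (pi / 2) * P xi.
  rewrite RintegralZr// Rintegral_itv_obnd_cbnd//.
  by rewrite (Rintegral_FTC2 xib dP cP1) Pb; ring.
under eq_fun do rewrite step.
have -> : pi * P xi = - (- (pi / 2) * P xi + - (pi / 2) * P xi) by field.
by apply: cvgN; apply: cvgD; [rewrite -E1|rewrite -E2].
Qed.

End poisson_kernel.

(** * Abel summation: inversion on the half-line *)

Section abel_summation.
Context {R : realType}.
Notation mu := (@lebesgue_measure R).
Implicit Types (P Q g h : R -> R) (a b x y xi e n M : R).

(** At the cut-off [e^(-3)] the exponential is [exp(- e^(-2))], at most [e^2] because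
    [1 + u <= exp u], and the bracket is at most [e + |y|]. What remains is
    [e^2 (e + |y|) <= 2 e (e^2 + y^2)], proved by completing a square. *)
Lemma abel_error (e : R) y : 0 < e -> e <= 1 ->
  `|expR (- e * e ^- 3) * (e * cos (e ^- 3 * y) - y * sin (e ^- 3 * y)) /
    (e ^+ 2 + y ^+ 2)| <= 2 * e.
Proof.
move=> e0 e1.
have D0 : 0 < e ^+ 2 + y ^+ 2 by rewrite ltr_pwDl ?sqr_ge0// exprn_gt0.
have E : expR (- e * e ^- 3) <= e ^+ 2.
  have -> : - e * e ^- 3 = - e ^- 2 by field; rewrite gt_eqF.
  rewrite expRN -[leRHS]invrK lef_pV2 ?posrE ?expR_gt0 ?invr_gt0 ?exprn_gt0//.
  by rewrite (le_trans _ (expR_ge1Dx _))// lerDr.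
rewrite normrM normrM normfV (gtr0_norm D0) ger0_norm ?expR_ge0//.
rewrite ler_pdivrMr//.
have H1 : `|e * cos (e ^- 3 * y) - y * sin (e ^- 3 * y)| <= e + `|y|.
  rewrite (le_trans (ler_normB _ _))// lerD// normrM.
    by rewrite (gtr0_norm e0) ler_piMr ?normr_cos_le1// ltW.
  by rewrite ler_piMr ?normr_sin_le1.
apply: (@le_trans _ _ (e ^+ 2 * (e + `|y|))); first by rewrite ler_pM ?expR_ge0.
have y0 : 0 <= `|y| by [].
rewrite -[y ^+ 2](real_normK (num_real y)).
move: y0; set t := `|y| => t0.
rewrite -subr_ge0.
have -> : 2 * e * (e ^+ 2 + t ^+ 2) - e ^+ 2 * (e + t) =
  e * ((e - t / 2) ^+ 2 + (7 / 4) * t ^+ 2) by field.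
apply: mulr_ge0; first exact: ltW.
apply: addr_ge0; first exact: sqr_ge0.
by apply: mulr_ge0; [lra|exact: sqr_ge0].
Qed.

(* Damping by [exp(- e x)] on [[0, e^(-3)]] with [e = harm k] makes the order of
   integration irrelevant; the cut-off at [e^(-3)] costs only [O(e)]. *)
Lemma Rintegral_half_inversion P P1 a b xi : a < xi < b ->
  (forall x, is_derive x 1 P (P1 x)) -> continuous P1 -> supported a b P ->
  mu.-integrable setT
    (EFin \o (fun x => \int[mu]_y (cos (x * (y - xi)) * P y))) ->
  \int[mu]_(x in `[0, +oo[) (\int[mu]_y (cos (x * (y - xi)) * P y)) = pi * P xi.
Proof.
move=> xiab dP cP1 sP; set h := fun x => _ => ih.
have cP := is_derive_continuous dP.
have [axi xib] := andP xiab; have ab := lt_trans axi xib.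
have iP := integrable_supp cP sP.
pose n k : R := harm k ^- 3.
have n0 k : 0 < n k by rewrite invr_gt0 exprn_gt0// harm_gt0.
have h1 k : harm k <= 1 :> R by rewrite invf_le1 ?ltr0n// ler1n.
pose A k := (fun x => expR (- harm k * x + 0)) \_ `[0, n k].
have cE k : continuous (fun x => expR (- harm k * x + 0)).
  by apply: continuous_compf; [exact: continuous_affine|exact: continuous_expR].
have iA k : mu.-integrable setT (EFin \o A k).
  rewrite /A -restrict_EFin; apply/(integrable_mkcond _ _).1 => //.
  exact: continuous_integrable_itv.
have mG : measurable_fun [set: R * R] (fun z : R * R => cos (z.1 * (z.2 - xi))).
  apply: measurableT_comp; first exact: (continuous_measurable_fun (@continuous_cos R)).
  apply: measurable_funM; first exact: measurable_fst.
  by apply: measurable_funB; [exact: measurable_snd|exact: measurable_cst].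
(* This damped integral is evaluated twice. Exchanging the integrations gives a Poisson integral
   with a small error, which tends to [pi P(xi)]; dominated convergence with majorant [|h|] gives
   the integral of [h] itself. *)
pose T k := \int[mu]_x (A k x * h x).
pose N k y := expR (- harm k * n k) * (harm k * cos (n k * (y - xi)) -
  (y - xi) * sin (n k * (y - xi))) / (harm k ^+ 2 + (y - xi) ^+ 2).
have D0 k y : harm k ^+ 2 + (y - xi) ^+ 2 != 0.
  by rewrite gt_eqF// ltr_pwDl ?sqr_ge0// exprn_gt0 ?harm_gt0.
have cB : continuous (fun y => y - xi).
  apply: continuous_addf => // y; first exact: cvg_id.
  exact: cst_continuous.
have cc (c : R) : continuous (fun _ : R => c) by move=> y; exact: cst_continuous.
have cD k : continuous (fun y => (harm k ^+ 2 + (y - xi) ^+ 2)^-1).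
  apply: continuous_invf => //; apply: continuous_addf => //.
  exact: continuous_mulf.
have cg k g : continuous g -> continuous (fun y => g (n k * (y - xi))).
  by move=> cg; apply: (continuous_compf _ cg); exact: continuous_mulf.
have cN k : continuous (N k).
  apply: continuous_mulf => //; apply: continuous_mulf => //.
  apply: continuous_addf.
    by apply: continuous_mulf => //; apply: cg; exact: continuous_cos.
  have cS : continuous (fun y => (y - xi) * sin (n k * (y - xi))).
    by apply: continuous_mulf => //; apply: cg; exact: continuous_sin.
  by apply: (continuous_compf cS); exact: opp_continuous.
have iPm g : continuous g -> mu.-integrable setT (EFin \o (fun y => P y * g y)).
  move=> cgg; apply: (@integrable_supp _ _ a b); first exact: continuous_mulf.
  by move=> y /sP ->; rewrite mul0r.
have iPN k : mu.-integrable setT (EFin \o (fun y => P y * N k y)) by exact: iPm.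
have TE k : T k = \int[mu]_y (P y * (harm k / (harm k ^+ 2 + (y - xi) ^+ 2))) -
   \int[mu]_y (P y * N k y).
  rewrite -RintegralB//; last by apply: iPm; exact: continuous_mulf.
  have [FK _] := Fubini_kernel mG (fun z => normr_cos_le1 _) (iA k) iP.
  rewrite /T [LHS]FK; apply: eq_Rintegral => y _.
  rewrite -mulrBr; congr (_ * _).
  rewrite -mulrBl -abel_kernel ?harm_gt0//.
  rewrite [RHS]Rintegral_mkcond; apply: eq_Rintegral => x _.
  by rewrite /A !patchE; case: ifP => // _; rewrite mulr0.
have T1 : T k @[k --> \oo] --> pi * P xi.
  under eq_fun do rewrite TE.
  rewrite -[pi * P xi]subr0; apply: cvgB; first exact: (cvg_poisson xiab dP cP1 sP).
  have iN : mu.-integrable setT (EFin \o (fun y => `|P y|)).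
    by have := integrable_abse iP; apply: eq_integrable.
  have B0 : 2 * harm k * \int[mu]_y `|P y| @[k --> \oo] --> (0 : R).
    have -> : 0 = 2 * 0 * \int[mu]_y `|P y| :> R by rewrite mulr0 mul0r.
    by apply: cvgMl; apply: cvgMr; exact: cvg_harm.
  have B0N : - (2 * harm k * \int[mu]_y `|P y|) @[k --> \oo] --> (0 : R).
    by rewrite -oppr0; exact: cvgN.
  apply: (squeeze_cvgr _ B0N B0); apply: nearW => k; rewrite -ler_norml.
  rewrite (le_trans (le_normr_Rintegral _ (iPN k)))//.
  rewrite -RintegralZl//; apply: le_Rintegral => //.
  - by have := integrable_abse (iPN k); apply: eq_integrable.
  - by have := integrableZl measurableT (2 * harm k) iN; apply: eq_integrable.
  - move=> y _; rewrite normrM mulrC ler_wpM2r//.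
    exact: abel_error (harm_gt0 k) (h1 k).
have T2 : T k @[k --> \oo] --> \int[mu]_(x in `[0, +oo[) h x.
  have TE2 k : T k = \int[mu]_(x in `[0, +oo[) (A k x * h x).
    rewrite [RHS]Rintegral_mkcond; apply: eq_Rintegral => x _.
    rewrite /A !patchE; case: ifPn => [|xn]; last by rewrite mul0r if_same.
    by rewrite inE/= in_itv/= => /andP[x0 _]; rewrite mem_set//= in_itv/= x0.
  under eq_fun do rewrite TE2.
  apply: (@Rintegral_dominated_cvg _ _ _ _ (fun x => `|h x|)) => //.
  - move=> k; apply: measurable_funTS; apply: measurable_funM.
      by apply/measurable_EFinP; exact: measurable_int (iA k).
    by apply/measurable_EFinP; exact: measurable_int ih.
  - move=> x /=; rewrite in_itv/= andbT => x0.
    suff: A k x * h x @[k --> \oo] --> 1 * h x by rewrite mul1r.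
    apply: cvgMl.
    have cx : expR (- harm k * x + 0) @[k --> \oo] --> (1 : R).
      have -> : 1 = expR (- 0 * x + 0) :> R by rewrite oppr0 mul0r addr0 expR0.
      apply: continuous_cvg; first exact: continuous_expR.
      apply: cvgD; last exact: cvg_cst.
      by apply: cvgMl; apply: cvgN; exact: cvg_harm.
    apply: cvg_trans cx; apply: near_eq_cvg.
    (* Once [x <= k + 1], also [x <= (k + 1)^3 = n k], and the cut-off no longer acts at [x]. *)
    have /cvgryPge/(_ x) := @cvgy_succn R; apply: filterS => k xk.
    rewrite /A patchE mem_set//= in_itv/= x0 /= (le_trans xk)//.
    by rewrite /n /harm exprVn invrK -[leLHS]expr1 ler_weXn2l// ler1n.
  - have ih' : mu.-integrable `[0, +oo[ (EFin \o h) by apply: integrableS ih.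
    by have := integrable_abse ih'; apply: eq_integrable.
  - move=> k x _; rewrite normrM ler_piMl// /A patchE; case: ifPn; rewrite ?normr0//.
    rewrite inE/= in_itv/= => /andP[x0 _]; rewrite ger0_norm ?expR_ge0// addr0.
    by rewrite -[leRHS]expR0 ler_expR mulNr oppr_le0 mulr_ge0// ltW// harm_gt0.
exact: (cvg_unique _ T2 T1).
Qed.

End abel_summation.

(** * Truncated powers, Bessel weights and C^2 bumps *)

Section test_functions.
Context {R : realType}.
Notation mu := (@lebesgue_measure R).
Implicit Types (P Q g h : R -> R) (a b x y xi t L M : R) (k : nat).

(** The third power is the lowest integer power of the positive part that is C^2. With exponent 0
    the value is 1 everywhere, so vanishing on the negative side starts at exponent 1. *)
Definition pospow k (t : R) : R := Num.max 0 t ^+ k.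

Lemma pospow_gt0 k t : 0 < t -> pospow k t = t ^+ k.
Proof. by move=> t0; rewrite /pospow max_r// ltW. Qed.

Lemma pospow_le0 k t : t <= 0 -> pospow k.+1 t = 0.
Proof. by move=> t0; rewrite /pospow max_l// expr0n. Qed.

Lemma continuous_pospow k : continuous (pospow k).
Proof.
have cm : continuous (fun t : R => Num.max 0 t).
  have -> : (fun t : R => Num.max 0 t) = (fun t => (t + `|t|) * 2^-1).
    by apply/funext => t; rewrite maxr_absE add0r sub0r normrN.
  apply: continuous_mulf; last by move=> t; exact: cst_continuous.
  apply: continuous_addf; last exact: norm_continuous.
  by move=> t; exact: cvg_id.
rewrite /pospow; elim: k => [|k IH].
  by under eq_fun do rewrite expr0; move=> t; exact: cst_continuous.
by under eq_fun do rewrite exprS; exact: continuous_mulf.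
Qed.

Lemma is_derive_exprn k x : is_derive x 1 (fun t : R => t ^+ k.+1) (k.+1%:R * x ^+ k).
Proof.
elim: k => [|k IH].
  have -> : (fun t : R => t ^+ 1) = id by apply/funext => t; rewrite expr1.
  by rewrite expr0 mulr1; exact: is_derive_id.
have -> : (fun t : R => t ^+ k.+2) = (fun t => t * t ^+ k.+1).
  by apply/funext => t; rewrite exprS.
apply: (is_derive_eq (is_derive_mul (is_derive_id x 1) IH)).
by rewrite !exprS -[k.+2%:R]natr1; ring.
Qed.

Lemma is_derive_pospow k x : is_derive x 1 (pospow k.+2) (k.+2%:R * pospow k.+1 x).
Proof.
have [x0|x0|->] := ltgtP x 0.
- rewrite pospow_le0 ?mulr0; last exact: ltW.
  apply: near_eq_is_derive (is_derive_cst x 0).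
  have := lt_nbhsl x0; apply: filterS => t t0.
  by rewrite pospow_le0// ltW.
- rewrite pospow_gt0//; apply: near_eq_is_derive (is_derive_exprn k.+1 x).
  have := lt_nbhsr x0; apply: filterS => t t0.
  by rewrite pospow_gt0.
- rewrite pospow_le0// mulr0.
  (* At the origin the difference quotient is [pospow k.+1 h] on both sides. *)
  have H : h^-1 *: (pospow k.+2 (h *: 1 + 0) - pospow k.+2 0) @[h --> 0^'] --> (0 : R).
    have c0 : pospow k.+1 h @[h --> 0^'] --> (0 : R).
      have := @continuous_pospow k.+1 0; rewrite /continuous_at pospow_le0//.
      exact: cvg_within_filter.
    apply: cvg_trans c0; apply: near_eq_cvg.
    near=> h.
    have h0 : h != 0 by near: h; exact: nbhs_dnbhs_neq.
    rewrite /GRing.scale /= mulr1 addr0 (@pospow_le0 _ 0)// subr0.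
    have [hn|hp] := leP h 0; first by rewrite !pospow_le0// mulr0.
    by rewrite !pospow_gt0// [in RHS]exprS mulKf.
  apply: DeriveDef; first by apply/cvg_ex; exists 0.
  exact: cvg_lim H.
Unshelve. all: by end_near. Qed.

(** The symbol of [(1 - Delta)^c]; it occurs with [c = s / 2] in the Bessel potential and
    [c = - (s / 2)] in the packet. *)
Definition weight (c x : R) : R := (1 + x ^+ 2) `^ c.

Lemma weight_gt0 c x : 0 < weight c x.
Proof. by rewrite powR_gt0// ltr_pwDl// sqr_ge0. Qed.

Lemma is_derive_weight c x : is_derive x 1 (weight c) (2 * c * x * weight (c - 1) x).
Proof.
have D0 : 0 < 1 + x ^+ 2 by rewrite ltr_pwDl// sqr_ge0.
have H := @is_derive_comp _ (fun z => z `^ c) (fun z => 1 + z ^+ 2) _ _ _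
  (is_derive1_powR c D0) (is_derive_add (is_derive_cst x 1) (is_derive_exprn 1 x)).
by apply: (is_derive_eq H); rewrite expr1 /weight; ring.
Qed.

Lemma continuous_weight c : continuous (weight c).
Proof. exact: is_derive_continuous (is_derive_weight c). Qed.

(** The normalisation makes it a function of [(x - a) / (b - a)] alone: its bounds are the same on
    every interval, and each derivative costs a factor [1 / (b - a)]. *)
Definition parab a b x : R := (x - a) * (b - x) / (b - a) ^+ 2.
Definition parab1 a b x : R := (a + b - 2 * x) / (b - a) ^+ 2.

Lemma is_derive_parab a b x : is_derive x 1 (parab a b) (parab1 a b x).
Proof.
have -> : parab a b = (fun x => (1 * x + - a) * (- 1 * x + b) * ((b - a) ^+ 2)^-1).
  by apply/funext => z; rewrite /parab; ring.
have H := is_derive_mul (is_derive_mul (is_derive_affine x 1 (- a))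
  (is_derive_affine x (- 1) b)) (is_derive_cst x ((b - a) ^+ 2)^-1).
by apply: (is_derive_eq H); rewrite /parab1; ring.
Qed.

Lemma is_derive_parab1 a b x : is_derive x 1 (parab1 a b) (- 2 / (b - a) ^+ 2).
Proof.
have -> : parab1 a b = (fun x => (- 2 * x + (a + b)) * ((b - a) ^+ 2)^-1).
  by apply/funext => z; rewrite /parab1; ring.
have H := is_derive_mul (is_derive_affine x (- 2) (a + b))
  (is_derive_cst x ((b - a) ^+ 2)^-1).
by apply: (is_derive_eq H); rewrite mulr0 addr0.
Qed.

Definition bump a b x : R := pospow 3 (parab a b x).
Definition bump1 a b x : R := 3 * pospow 2 (parab a b x) * parab1 a b x.
Definition bump2 a b x : R :=
  6 * pospow 1 (parab a b x) * parab1 a b x ^+ 2 +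
  3 * pospow 2 (parab a b x) * (- 2 / (b - a) ^+ 2).

Lemma is_derive_bump a b x : is_derive x 1 (bump a b) (bump1 a b x).
Proof. exact: (is_derive_comp (is_derive_pospow 1 _) (is_derive_parab a b x)). Qed.

Lemma is_derive_bump1 a b x : is_derive x 1 (bump1 a b) (bump2 a b x).
Proof.
have H := is_derive_mul (is_derive_mul (is_derive_cst x 3)
  (is_derive_comp (is_derive_pospow 0 _) (is_derive_parab a b x)))
  (is_derive_parab1 a b x).
by apply: (is_derive_eq H); rewrite /bump2; ring.
Qed.

Lemma continuous_parab a b : continuous (parab a b).
Proof. exact: is_derive_continuous (is_derive_parab a b). Qed.

Lemma continuous_parab1 a b : continuous (parab1 a b).
Proof. exact: is_derive_continuous (is_derive_parab1 a b). Qed.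

Lemma continuous_bump a b : continuous (bump a b).
Proof. exact: is_derive_continuous (is_derive_bump a b). Qed.

Lemma continuous_bump1 a b : continuous (bump1 a b).
Proof. exact: is_derive_continuous (is_derive_bump1 a b). Qed.

Lemma continuous_bump2 a b : continuous (bump2 a b).
Proof.
have cc (c : R) : continuous (fun _ : R => c) by move=> y; exact: cst_continuous.
have cp k : continuous (fun x => pospow k (parab a b x)).
  by apply: continuous_compf; [exact: continuous_parab|exact: continuous_pospow].
have c1 := @continuous_parab1 a b.
apply: continuous_addf.
  apply: continuous_mulf; first exact: continuous_mulf.
  exact: (continuous_mulf c1 c1).
by apply: continuous_mulf => //; exact: continuous_mulf.
Qed.

Lemma parab_le0 a b x : a < b -> ~~ (a < x < b) -> parab a b x <= 0.
Proof.
move=> ab xab; rewrite /parab pmulr_lle0; last by rewrite invr_gt0 exprn_gt0// subr_gt0.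
move: xab; rewrite negb_and -!leNgt => /orP[xa|bx].
  by nra.
by nra.
Qed.

Lemma supported_bump a b : a < b -> supported a b (bump a b).
Proof. by move=> ab x xab; rewrite /bump pospow_le0// parab_le0. Qed.

Lemma supported_bump1 a b : a < b -> supported a b (bump1 a b).
Proof. by move=> ab x xab; rewrite /bump1 pospow_le0 ?parab_le0// mulr0 mul0r. Qed.

Lemma supported_bump2 a b : a < b -> supported a b (bump2 a b).
Proof.
by move=> ab x xab; rewrite /bump2 !pospow_le0 ?parab_le0// !mulr0 !mul0r addr0.
Qed.

Lemma bump_ge0 a b x : 0 <= bump a b x.
Proof. by rewrite /bump /pospow exprn_ge0// le_max lexx. Qed.

Lemma parab_bounds a b x : a < x < b -> 0 < parab a b x <= 1.
Proof.
move=> /andP[ax xb]; have D0 : 0 < (b - a) ^+ 2 by rewrite exprn_gt0// subr_gt0 (lt_trans ax).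
apply/andP; split; first by rewrite /parab divr_gt0// mulr_gt0 ?subr_gt0.
by rewrite /parab ler_pdivrMr// mul1r; nra.
Qed.

Lemma bump_le1 a b x : a < b -> `|bump a b x| <= 1.
Proof.
move=> ab; have [/parab_bounds/andP[p0 p1]|xab] := boolP (a < x < b).
  by rewrite ger0_norm ?bump_ge0// /bump pospow_gt0// exprn_ile1// ltW.
by rewrite supported_bump// normr0.
Qed.

(** With [p] the parabola and [q = (a + b - 2 x) / (b - a)], the second derivative times [(b - a)^2]
    is [6 p q^2 - 6 p^2]. On the support [p] and [q^2] lie between 0 and 1, so each term is at most
    6. *)
Lemma bump2_le a b x : a < b -> `|bump2 a b x| <= 12 / (b - a) ^+ 2.
Proof.
move=> ab; have L0 : 0 < b - a by rewrite subr_gt0.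
have D0 : 0 < (b - a) ^+ 2 by rewrite exprn_gt0.
have [xab|xab] := boolP (a < x < b); last first.
  by rewrite supported_bump2// normr0 divr_ge0// ltW.
have /andP[p0 p1] := parab_bounds xab.
rewrite /bump2 !pospow_gt0// expr1; set p := parab a b x in p0 p1 *.
have -> : 6 * p * parab1 a b x ^+ 2 + 3 * p ^+ 2 * (- 2 / (b - a) ^+ 2) =
  (6 * p * ((a + b - 2 * x) / (b - a)) ^+ 2 - 6 * p ^+ 2) / (b - a) ^+ 2.
  by rewrite /parab1; field; rewrite gt_eqF.
rewrite normrM [`|_^-1|]gtr0_norm ?invr_gt0// ler_pM2r ?invr_gt0//.
set q := (a + b - 2 * x) / (b - a).
have q1 : q ^+ 2 <= 1.
  have q2 : `|q| <= 1.
    rewrite /q normrM normfV (gtr0_norm L0) ler_pdivrMr// mul1r ler_norml.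
    by case/andP: xab => ax xb; apply/andP; split; lra.
  by rewrite -real_normK ?num_real// exprn_ile1.
have q0 : 0 <= q ^+ 2 by exact: sqr_ge0.
move: q0 q1; set r := q ^+ 2 => r0 r1.
by rewrite ler_norml; apply/andP; split; nra.
Qed.

(** On the middle half the parabola is at least [1/4 * 3/4 = 3/16], which exceeds [1/8]. *)
Lemma bump_middle a b x : a < b -> a + (b - a) / 4 <= x <= b - (b - a) / 4 ->
  (8^-1) ^+ 3 <= bump a b x.
Proof.
move=> ab /andP[ax xb]; have D0 : 0 < (b - a) ^+ 2 by rewrite exprn_gt0// subr_gt0.
have p0 : 8^-1 <= parab a b x by rewrite /parab ler_pdivlMr//; nra.
rewrite /bump pospow_gt0; last exact: lt_le_trans p0.
by rewrite lerXn2r// nnegrE ?invr_ge0// (le_trans _ p0)// invr_ge0.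
Qed.

Lemma supported_bounded a b Q : a <= b -> supported a b Q -> continuous Q ->
  exists M, forall x, `|Q x| <= M.
Proof.
move=> ab sQ cQ; have cn : continuous (fun x => `|Q x|).
  by apply: continuous_compf => //; exact: norm_continuous.
have [c _ cM] := EVT_max ab (continuous_subspaceT cn).
exists (`|Q c|) => x; have [/andP[ax xb]|xab] := boolP (a < x < b).
  by apply: cM; rewrite in_itv/= !ltW.
by rewrite sQ// normr0.
Qed.

End test_functions.

(** * Inversion and symmetry of the cosine and sine transforms *)

Section fourier_inversion.
Context {R : realType}.
Notation mu := (@lebesgue_measure R).
Implicit Types (P Q g h A B : R -> R) (a b x y xi t L M : R) (k : nat).

Definition C2_supported a b P (P1 P2 : R -> R) : Prop :=
  [/\ forall x, is_derive x 1 P (P1 x), forall x, is_derive x 1 P1 (P2 x),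
      continuous P2 & [/\ supported a b P, supported a b P1 & supported a b P2]].

Lemma C2_supported_bump a b : a < b ->
  C2_supported a b (bump a b) (bump1 a b) (bump2 a b).
Proof.
move=> ab; split; [exact: is_derive_bump|exact: is_derive_bump1|exact: continuous_bump2|].
by split; [exact: supported_bump|exact: supported_bump1|exact: supported_bump2].
Qed.

(** The derivatives are only asserted to exist: they make the packet invertible, while the bounds
    uniform in the interval are taken from the unweighted bump. *)
Lemma C2_supported_weight_bump a b c : a < b -> exists P1 P2 : R -> R,
  C2_supported a b (fun x => weight c x * bump a b x) P1 P2.
Proof.
move=> ab.
pose w1 (x : R) := 2 * c * x * weight (c - 1) x.
pose w2 (x : R) := 2 * c * weight (c - 1) x +
  2 * c * x * (2 * (c - 1) * x * weight (c - 1 - 1) x).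
have dw1 (x : R) : is_derive x 1 w1 (w2 x).
  have H := is_derive_mul (is_derive_affine x (2 * c) 0) (is_derive_weight (c - 1) x).
  have -> : w1 = (fun z => (2 * c * z + 0) * weight (c - 1) z).
    by apply/funext => z; rewrite /w1 addr0.
  by apply: (is_derive_eq H); rewrite /w2 addr0.
exists (fun x => w1 x * bump a b x + weight c x * bump1 a b x).
exists (fun x => (w2 x * bump a b x + w1 x * bump1 a b x) +
  (w1 x * bump1 a b x + weight c x * bump2 a b x)).
have cw1 : continuous w1 by exact: is_derive_continuous dw1.
have cc (d : R) : continuous (fun _ : R => d) by move=> y; exact: cst_continuous.
have cid : continuous (fun x : R => x) by move=> x; exact: cvg_id.
have cw2 : continuous w2.
  apply: continuous_addf; first by apply: continuous_mulf => //; exact: continuous_weight.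
  have c1 : continuous (fun x : R => 2 * c * x) by exact: continuous_mulf.
  apply: continuous_mulf => //; apply: continuous_mulf; last exact: continuous_weight.
  exact: continuous_mulf.
split.
- by move=> x; exact: is_derive_mul (is_derive_weight c x) (is_derive_bump a b x).
- move=> x; apply: is_derive_add.
    exact: is_derive_mul (dw1 x) (is_derive_bump a b x).
  exact: is_derive_mul (is_derive_weight c x) (is_derive_bump1 a b x).
- have := @continuous_bump R a b; have := @continuous_bump1 R a b.
  have := @continuous_bump2 R a b; have := @continuous_weight R c => *.
  by apply: continuous_addf; apply: continuous_addf; exact: continuous_mulf.
- split=> x xab; rewrite ?supported_bump ?supported_bump1 ?supported_bump2//; ring.
Qed.

Lemma integrable_le_oneDsqrV h (K : R) : continuous h ->
  (forall x, `|h x| <= K / (1 + (1 * x) ^+ 2)) -> mu.-integrable setT (EFin \o h).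
Proof.
move=> ch hK.
have iK := integrableZl measurableT K (integrable_oneDsqrV (@ltr01 R)).
have iK' : mu.-integrable setT (EFin \o (fun x => K * (1 + (1 * x) ^+ 2)^-1)).
  by move: iK; apply: eq_integrable.
apply: integrable_le_norm iK' _ => //.
- exact: continuous_measurable_fun.
- by move=> x _; rewrite (le_trans (hK x))// ler_norm.
Qed.

Lemma integrable_transforms P (P1 P2 : R -> R) a b : a < b -> C2_supported a b P P1 P2 ->
  mu.-integrable setT (EFin \o cos_transform P) /\
  mu.-integrable setT (EFin \o sin_transform P).
Proof.
move=> ab [dP dP1 cP2 [sP sP1 sP2]].
have cP := is_derive_continuous dP.
have iP := integrable_supp cP sP.
have [M PM] := supported_bounded (ltW ab) sP cP.
have [M2 PM2] := supported_bounded (ltW ab) sP2 cP2.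
have PM' x : `|P x| <= Num.max M M2 by rewrite le_max PM.
have PM2' x : `|P2 x| <= Num.max M M2 / 1 ^+ 2 by rewrite expr1n divr1 le_max PM2 orbT.
split.
- apply: (@integrable_le_oneDsqrV _ (2 * Num.max M M2 * (b - a))).
    exact: continuous_cos_transform.
  by move=> x; exact: (cos_transform_decay _ ab ltr01 dP dP1).
- apply: (@integrable_le_oneDsqrV _ (2 * Num.max M M2 * (b - a))).
    exact: continuous_sin_transform.
  by move=> x; exact: (sin_transform_decay _ ab ltr01 dP dP1).
Qed.

Lemma integrable_mul_le1 g A : continuous g -> (forall x, `|g x| <= 1) ->
  mu.-integrable setT (EFin \o A) -> mu.-integrable setT (EFin \o (fun x => g x * A x)).
Proof.
move=> cg g1 iA; have mA : measurable_fun setT A.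
  by apply/measurable_EFinP; exact: measurable_int iA.
apply: integrable_le_norm iA _ => //.
  by apply: measurable_funM mA; exact: continuous_measurable_fun.
by move=> x _; rewrite normrM ler_piMl.
Qed.

Lemma integrable_cosM A xi : mu.-integrable setT (EFin \o A) ->
  mu.-integrable setT (EFin \o (fun x => cos (xi * x) * A x)).
Proof.
apply: integrable_mul_le1 => [|x]; last exact: normr_cos_le1.
by apply: continuous_kernel; exact: continuous_cos.
Qed.

Lemma integrable_sinM A xi : mu.-integrable setT (EFin \o A) ->
  mu.-integrable setT (EFin \o (fun x => sin (xi * x) * A x)).
Proof.
apply: integrable_mul_le1 => [|x]; last exact: normr_sin_le1.
by apply: continuous_kernel; exact: continuous_sin.
Qed.

(** These are the real and imaginary parts of the integral of [e^(- i x xi) (C(x) + i S(x))], where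
    [C] and [S] are the transforms of [P]. The first integrand is even in [x], so folding reduces it
    to the half-line; the second is odd and folds to zero. *)
Lemma transforms_inversion P (P1 P2 : R -> R) a b xi : a < b -> C2_supported a b P P1 P2 ->
  cos_transform (cos_transform P) xi + sin_transform (sin_transform P) xi = 2 * pi * P xi /\
  cos_transform (sin_transform P) xi - sin_transform (cos_transform P) xi = 0.
Proof.
move=> ab CP; have [iC iS] := integrable_transforms ab CP.
have [dP dP1 cP2 [sP sP1 sP2]] := CP.
have cP := is_derive_continuous dP; have iP := integrable_supp cP sP.
have cP1 := is_derive_continuous dP1.
have cC := continuous_cos_transform cP iP; have cS := continuous_sin_transform cP iP.
have icC := integrable_cosM xi iC; have icS := integrable_cosM xi iS.
have isC := integrable_sinM xi iC; have isS := integrable_sinM xi iS.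
have kc := @continuous_kernel _ _ xi (@continuous_cos R).
have ks := @continuous_kernel _ _ xi (@continuous_sin R).
split; rewrite /cos_transform /sin_transform -?RintegralD -?RintegralB//.
- set h := fun x => cos (xi * x) * cos_transform P x + sin (xi * x) * sin_transform P x.
  have ch : continuous h by apply: continuous_addf; exact: continuous_mulf.
  have ih : mu.-integrable setT (EFin \o h).
    by have := integrableD measurableT icC isS; apply: eq_integrable.
  have hE x : h x = \int[mu]_y (cos (x * (y - xi)) * P y).
    rewrite /h -!RintegralZl//; [|exact: integrable_sinM|exact: integrable_cosM].
    rewrite -RintegralD//; last 2 first.
    - have := integrableZl measurableT (cos (xi * x)) (integrable_cosM x iP).
      by apply: eq_integrable.
    - have := integrableZl measurableT (sin (xi * x)) (integrable_sinM x iP).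
      by apply: eq_integrable.
    apply: eq_Rintegral => y _; rewrite mulrBr cosB (mulrC x xi); ring.
  have hN x : h (- x) = h x.
    by rewrite /h !mulrN cosN sinN cos_transformN sin_transformN//; ring.
  transitivity (\int[mu]_x h x) => //.
  rewrite Rintegral_fold//.
  under eq_Rintegral do rewrite hN -mulr2n -mulr_natl.
  have ih' : mu.-integrable `[0%R, +oo[ (EFin \o h) by apply: integrableS ih.
  rewrite RintegralZl// -mulrA; congr (_ * _).
  under eq_Rintegral do rewrite hE.
  (* [xi] may lie outside the support; the interval is enlarged to contain it strictly, and [P]
     vanishes on the added part. *)
  have m1 : Num.min a xi <= a by rewrite ge_min lexx.
  have m2 : Num.min a xi <= xi by rewrite ge_min lexx orbT.
  have m3 : b <= Num.max b xi by rewrite le_max lexx.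
  have m4 : xi <= Num.max b xi by rewrite le_max lexx orbT.
  apply: (@Rintegral_half_inversion _ P P1 (Num.min a xi - 1) (Num.max b xi + 1)) => //.
  + by apply/andP; split; lra.
  + move=> x xab; apply: sP; apply: contra xab => /andP[ax xb].
    by apply/andP; split; lra.
  + move: ih; apply: eq_integrable => // x _ /=; by rewrite hE.
- set h := fun x => cos (xi * x) * sin_transform P x - sin (xi * x) * cos_transform P x.
  have ch : continuous h.
    apply: continuous_addf; first exact: continuous_mulf.
    by apply: (continuous_compf (continuous_mulf ks cC)); exact: opp_continuous.
  have ih : mu.-integrable setT (EFin \o h).
    by have := integrableB measurableT icS isC; apply: eq_integrable.
  have hN x : h (- x) = - h x.
    by rewrite /h !mulrN cosN sinN cos_transformN sin_transformN//; ring.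
  transitivity (\int[mu]_x h x) => //.
  rewrite Rintegral_fold//.
  under eq_Rintegral do rewrite hN subrr.
  by rewrite Rintegral_cst// mul0r.
Qed.

Lemma cos_transform_sym A B : mu.-integrable setT (EFin \o A) ->
  mu.-integrable setT (EFin \o B) ->
  \int[mu]_x (A x * cos_transform B x) = \int[mu]_x (B x * cos_transform A x) /\
  mu.-integrable setT (EFin \o (fun x => A x * cos_transform B x)).
Proof.
move=> iA iB.
have mG : measurable_fun [set: R * R] (fun z : R * R => cos (z.1 * z.2)).
  apply: measurableT_comp; first exact: (continuous_measurable_fun (@continuous_cos R)).
  by apply: measurable_funM; [exact: measurable_fst|exact: measurable_snd].
have [FK FI] := Fubini_kernel mG (fun z => normr_cos_le1 _) iA iB.
split; last exact: FI.
rewrite [LHS]FK; apply: eq_Rintegral => y _; congr (_ * _).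
by apply: eq_Rintegral => x _; rewrite /= (mulrC x).
Qed.

Lemma sin_transform_sym A B : mu.-integrable setT (EFin \o A) ->
  mu.-integrable setT (EFin \o B) ->
  \int[mu]_x (A x * sin_transform B x) = \int[mu]_x (B x * sin_transform A x) /\
  mu.-integrable setT (EFin \o (fun x => A x * sin_transform B x)).
Proof.
move=> iA iB.
have mG : measurable_fun [set: R * R] (fun z : R * R => sin (z.1 * z.2)).
  apply: measurableT_comp; first exact: (continuous_measurable_fun (@continuous_sin R)).
  by apply: measurable_funM; [exact: measurable_fst|exact: measurable_snd].
have [FK FI] := Fubini_kernel mG (fun z => normr_sin_le1 _) iA iB.
split; last exact: FI.
rewrite [LHS]FK; apply: eq_Rintegral => y _; congr (_ * _).
by apply: eq_Rintegral => x _; rewrite /= (mulrC x).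
Qed.

End fourier_inversion.

(** * The complex Fourier transform: multiplication formula and inversion *)

Section complex_fourier.
Context {R : realType}.
Notation mu := (@lebesgue_measure R).
Implicit Types (P Q g h A B : R -> R) (a b x y xi t L M : R) (k : nat).
Implicit Types (f phi psi : R -> R[i]%C) (z w : R[i]%C).

Lemma Re_mul z w : complex.Re (z * w) = complex.Re z * complex.Re w - complex.Im z * complex.Im w.
Proof. by case: z => ? ?; case: w. Qed.

Lemma Im_mul z w : complex.Im (z * w) = complex.Re z * complex.Im w + complex.Im z * complex.Re w.
Proof. by case: z => ? ?; case: w. Qed.

Lemma Re_add z w : complex.Re (z + w) = complex.Re z + complex.Re w.
Proof. by case: z => ? ?; case: w. Qed.

Lemma Im_add z w : complex.Im (z + w) = complex.Im z + complex.Im w.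
Proof. by case: z => ? ?; case: w. Qed.

Lemma complex_ext z w : complex.Re z = complex.Re w -> complex.Im z = complex.Im w -> z = w.
Proof. by case: z => ? ?; case: w => ? ? /= -> ->. Qed.

Lemma cabs_le z : cabs z <= `|complex.Re z| + `|complex.Im z|.
Proof.
case: z => p q; rewrite /cabs /ComplexField.Normc.normc /=.
rewrite -[leRHS]ger0_norm ?addr_ge0// -sqrtr_sqr ler_wsqrtr// sqrrD.
by rewrite !real_normK ?num_real// lerD2r lerDl mulrn_wge0// mulr_ge0.
Qed.

Lemma normr_Re_le z : `|complex.Re z| <= cabs z.
Proof.
case: z => p q; rewrite /cabs /ComplexField.Normc.normc /= -sqrtr_sqr ler_wsqrtr//.
by rewrite lerDl sqr_ge0.
Qed.

Lemma cabs_sqr z : cabs z ^+ 2 = complex.Re z ^+ 2 + complex.Im z ^+ 2.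
Proof. by case: z => p q; rewrite /cabs /= sqr_sqrtr// addr_ge0 ?sqr_ge0. Qed.

Lemma Re_fourier phi xi : cintegrable phi ->
  complex.Re (fourier phi xi) = cos_transform (re phi) xi + sin_transform (im phi) xi.
Proof.
move=> [ir ii]; rewrite /fourier /cint /= /cos_transform /sin_transform.
rewrite -RintegralD//; [|exact: integrable_cosM|exact: integrable_sinM].
by apply: eq_Rintegral => x _; rewrite /re Re_mul /= cosN sinN /im (mulrC x); ring.
Qed.

Lemma Im_fourier phi xi : cintegrable phi ->
  complex.Im (fourier phi xi) = cos_transform (im phi) xi - sin_transform (re phi) xi.
Proof.
move=> [ir ii]; rewrite /fourier /cint /= /cos_transform /sin_transform.
rewrite -RintegralB//; [|exact: integrable_cosM|exact: integrable_sinM].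
by apply: eq_Rintegral => x _; rewrite /im Im_mul /= cosN sinN /re (mulrC x); ring.
Qed.

Lemma re_mul_fourier f phi x : cintegrable phi ->
  re (fun x => f x * fourier phi x) x =
  (re f x * cos_transform (re phi) x + re f x * sin_transform (im phi) x) -
  (im f x * cos_transform (im phi) x - im f x * sin_transform (re phi) x).
Proof.
move=> cphi; have h1 := Re_fourier x cphi; have h2 := Im_fourier x cphi.
transitivity (re f x * complex.Re (fourier phi x) - im f x * complex.Im (fourier phi x)).
  exact: Re_mul.
by rewrite h1 h2 mulrDr mulrBr.
Qed.

Lemma im_mul_fourier f phi x : cintegrable phi ->
  im (fun x => f x * fourier phi x) x =
  (re f x * cos_transform (im phi) x - re f x * sin_transform (re phi) x) +
  (im f x * cos_transform (re phi) x + im f x * sin_transform (im phi) x).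
Proof.
move=> cphi; have h1 := Re_fourier x cphi; have h2 := Im_fourier x cphi.
transitivity (re f x * complex.Im (fourier phi x) + im f x * complex.Re (fourier phi x)).
  exact: Im_mul.
by rewrite h1 h2 mulrBr mulrDr.
Qed.

(** The multiplication formula. Real and imaginary parts of [f] and [phi] form four pairs, each met
    by both transforms; in all eight integrals the symmetric kernel lets the transform change
    sides. *)
Lemma fourier_dist_fun_dist f phi : cintegrable f -> cintegrable phi ->
  fourier_dist (fun_dist f) phi = fun_dist (fourier f) phi.
Proof.
move=> cf cphi; have [iA iB] := cf; have [iC iD] := cphi.
have [c1 ic1] := cos_transform_sym iA iC; have [c2 ic2] := cos_transform_sym iA iD.
have [c3 ic3] := cos_transform_sym iB iC; have [c4 ic4] := cos_transform_sym iB iD.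
have [s1 is1] := sin_transform_sym iA iC; have [s2 is2] := sin_transform_sym iA iD.
have [s3 is3] := sin_transform_sym iB iC; have [s4 is4] := sin_transform_sym iB iD.
have [_ jc1] := cos_transform_sym iC iA; have [_ jc2] := cos_transform_sym iD iA.
have [_ jc3] := cos_transform_sym iC iB; have [_ jc4] := cos_transform_sym iD iB.
have [_ js1] := sin_transform_sym iC iA; have [_ js2] := sin_transform_sym iD iA.
have [_ js3] := sin_transform_sym iC iB; have [_ js4] := sin_transform_sym iD iB.
have four (F1 F2 F3 F4 : R -> R) : mu.-integrable setT (EFin \o F1) ->
    mu.-integrable setT (EFin \o F2) -> mu.-integrable setT (EFin \o F3) ->
    mu.-integrable setT (EFin \o F4) ->
    (\int[mu]_x ((F1 x + F2 x) - (F3 x - F4 x)) =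
    \int[mu]_x F1 x + \int[mu]_x F2 x - (\int[mu]_x F3 x - \int[mu]_x F4 x)) /\
    (\int[mu]_x ((F1 x - F2 x) + (F3 x + F4 x)) =
    \int[mu]_x F1 x - \int[mu]_x F2 x + (\int[mu]_x F3 x + \int[mu]_x F4 x)).
  move=> i1 i2 i3 i4.
  have a12 : mu.-integrable setT (EFin \o (fun x => F1 x + F2 x)).
    by have := integrableD measurableT i1 i2; apply: eq_integrable.
  have b34 : mu.-integrable setT (EFin \o (fun x => F3 x - F4 x)).
    by have := integrableB measurableT i3 i4; apply: eq_integrable.
  have b12 : mu.-integrable setT (EFin \o (fun x => F1 x - F2 x)).
    by have := integrableB measurableT i1 i2; apply: eq_integrable.
  have a34 : mu.-integrable setT (EFin \o (fun x => F3 x + F4 x)).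
    by have := integrableD measurableT i3 i4; apply: eq_integrable.
  split.
  - transitivity (\int[mu]_x (F1 x + F2 x) - \int[mu]_x (F3 x - F4 x)).
      exact: (RintegralB measurableT a12 b34).
    congr (_ - _); [exact: (RintegralD measurableT i1 i2)|].
    exact: (RintegralB measurableT i3 i4).
  - transitivity (\int[mu]_x (F1 x - F2 x) + \int[mu]_x (F3 x + F4 x)).
      exact: (RintegralD measurableT b12 a34).
    congr (_ + _); [exact: (RintegralB measurableT i1 i2)|].
    exact: (RintegralD measurableT i3 i4).
(* Exchanging [f] and [phi] permutes the four terms of each part; [comb1] and [comb2] record the
   permutation for the real and the imaginary part. *)
have comb1 (p1 p2 p3 p4 q1 q2 q3 q4 : R) : p1 = q1 -> p2 = q2 -> p3 = q3 -> p4 = q4 ->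
  p1 + p2 - (p3 - p4) = q1 + q4 - (q3 - q2) by move=> -> -> -> ->; ring.
have comb2 (p1 p2 p3 p4 q1 q2 q3 q4 : R) : p1 = q1 -> p2 = q2 -> p3 = q3 -> p4 = q4 ->
  p1 - p2 + (p3 + p4) = q3 - q2 + (q1 + q4) by move=> -> -> -> ->; ring.
have mulfC : (fun x => fourier f x * phi x) = (fun x => phi x * fourier f x).
  by apply/funext => x; rewrite mulrC.
rewrite /fourier_dist /fun_dist /cint mulfC; apply: complex_ext => /=.
- have [H1 _] := four _ _ _ _ ic1 is2 ic4 is3.
  have [H2 _] := four _ _ _ _ jc1 js3 jc4 js2.
  rewrite (funext (fun x => re_mul_fourier f x cphi)).
  rewrite (funext (fun x => re_mul_fourier phi x cf)).
  apply: (etrans H1); apply/esym/(etrans H2)/esym.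
  exact: (comb1 _ _ _ _ _ _ _ _ c1 s2 c4 s3).
- have [_ H1] := four _ _ _ _ ic2 is1 ic3 is4.
  have [_ H2] := four _ _ _ _ jc3 js1 jc2 js4.
  rewrite (funext (fun x => im_mul_fourier f x cphi)).
  rewrite (funext (fun x => im_mul_fourier phi x cf)).
  apply: (etrans H1); apply/esym/(etrans H2)/esym.
  exact: (comb2 _ _ _ _ _ _ _ _ c2 s1 c3 s4).
Qed.

Definition inv_fourier P : R -> R[i]%C := fun x =>
  Complex ((2 * pi)^-1 * cos_transform P x) ((2 * pi)^-1 * sin_transform P x).

Lemma cintegrable_inv_fourier P (P1 P2 : R -> R) a b : a < b -> C2_supported a b P P1 P2 ->
  cintegrable (inv_fourier P).
Proof.
move=> ab /(integrable_transforms ab)[iC iS]; split.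
- by have := integrableZl measurableT (2 * pi)^-1 iC; apply: eq_integrable.
- by have := integrableZl measurableT (2 * pi)^-1 iS; apply: eq_integrable.
Qed.

Lemma fourier_inv_fourier P (P1 P2 : R -> R) a b xi : a < b -> C2_supported a b P P1 P2 ->
  fourier (inv_fourier P) xi = (P xi)%:C%C.
Proof.
move=> ab CP; have ci := cintegrable_inv_fourier ab CP.
have [iC iS] := integrable_transforms ab CP.
have [E1 E2] := transforms_inversion xi ab CP.
have p0 : pi != 0 :> R by rewrite gt_eqF// pi_gt0.
have cZ F : mu.-integrable setT (EFin \o F) ->
    cos_transform (fun x => (2 * pi)^-1 * F x) xi = (2 * pi)^-1 * cos_transform F xi.
  move=> iF; rewrite -RintegralZl//; last exact: integrable_cosM.
  by apply: eq_Rintegral => x _; ring.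
have sZ F : mu.-integrable setT (EFin \o F) ->
    sin_transform (fun x => (2 * pi)^-1 * F x) xi = (2 * pi)^-1 * sin_transform F xi.
  move=> iF; rewrite -RintegralZl//; last exact: integrable_sinM.
  by apply: eq_Rintegral => x _; ring.
apply: complex_ext; rewrite ?Re_fourier ?Im_fourier// /inv_fourier /re /im /= cZ// sZ//.
- by rewrite -mulrDr E1 mulKf// mulf_neq0// pnatr_eq0.
- by rewrite -mulrBr E2 mulr0.
Qed.

End complex_fourier.

(** * The wave packet as an element of [H^s] *)

Section sobolev_bump.
Context {R : realType}.
Notation mu := (@lebesgue_measure R).
Implicit Types (P Q g h A B : R -> R) (a b x y xi t L M c s : R) (k : nat).
Implicit Types (f phi psi : R -> R[i]%C) (z w : R[i]%C).

Lemma schwartz_continuous phi : schwartz phi -> continuous (re phi) /\ continuous (im phi).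
Proof.
move=> [d _]; split=> x; apply: differentiable_continuous; apply/derivable1_diffP.
  by have [] := d 0%N x.
by have [] := d 0%N x.
Qed.

(** The coefficients of [1 + 2 x^2 + x^4] add up to 4, so seminorm bounds [M] of orders 0, 2 and 4
    give [4 M]. Of the two factors [1 + x^2], one is to absorb a weight and one to ensure
    integrability. *)
Lemma schwartz_decay phi : schwartz phi -> exists2 M, 0 <= M & forall x,
  `|re phi x| * (1 + x ^+ 2) ^+ 2 <= M /\ `|im phi x| * (1 + x ^+ 2) ^+ 2 <= M.
Proof.
move=> [_ sch]; have [M HM] := sch 4%N.
have H (F : R -> R) x : (forall j, (j <= 4)%N -> `|x ^+ j * F x| <= M) ->
    `|F x| * (1 + x ^+ 2) ^+ 2 <= 4 * M.
  move=> HF; have := HF 0%N isT; have := HF 2%N isT; have := HF 4%N isT.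
  have E j : `|x ^+ j * F x| = `|x ^+ j| * `|F x| by exact: normrM.
  rewrite !E expr0 normr1 mul1r (ger0_norm (sqr_ge0 x)).
  have -> : `|x ^+ 4| = (x ^+ 2) ^+ 2 by rewrite ger0_norm -?exprM// exprn_even_ge0.
  set v := `|F x|; set q := x ^+ 2 => h4 h2 h0.
  have -> : v * (1 + q) ^+ 2 = v + 2 * (q * v) + q ^+ 2 * v by ring.
  lra.
exists (4 * M).
  have [h _] := HM 0%N 0%N isT isT 0; rewrite mulr_ge0// (le_trans _ h)//.
by move=> x; split; apply: H => j j4; have [] := HM j 0%N j4 isT x.
Qed.

(** For [c <= 1] the weight is at most [1 + x^2]. With [c = s / 2] this is the source of the
    condition [s <= 2] below, harmless because every threshold is at most [1/2]. *)
Lemma schwartz_weight c phi : c <= 1 -> schwartz phi ->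
  cintegrable (fun xi => (weight c xi)%:C%C * phi xi).
Proof.
move=> c1 sphi; have [cr ci] := schwartz_continuous sphi.
have [M M0 HM] := schwartz_decay sphi.
have H (F : R -> R) : continuous F -> (forall x, `|F x| * (1 + x ^+ 2) ^+ 2 <= M) ->
    mu.-integrable setT (EFin \o (fun x => weight c x * F x)).
  move=> cF HF; apply: (@integrable_le_oneDsqrV _ _ M).
    by apply: continuous_mulf => //; exact: continuous_weight.
  move=> x; rewrite mul1r; have D1 : 1 <= 1 + x ^+ 2 by rewrite lerDl sqr_ge0.
  have D0 : 0 < 1 + x ^+ 2 by rewrite (lt_le_trans ltr01).
  rewrite ler_pdivlMr// normrM (gtr0_norm (weight_gt0 _ _)).
  apply: le_trans (HF x); rewrite expr2 mulrA ler_pM2r// mulrC ler_wpM2l//.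
  by rewrite /weight -[leRHS]powRr1 ?(ltW D0)// ler_powR.
split.
- have := H _ cr (fun x => (HM x).1); apply: eq_integrable => // x _.
  by rewrite /= /re Re_mul /=; congr EFin; ring.
- have := H _ ci (fun x => (HM x).2); apply: eq_integrable => // x _.
  by rewrite /= /im Im_mul /=; congr EFin; ring.
Qed.

Lemma schwartz_cintegrable phi : schwartz phi -> cintegrable phi.
Proof.
move=> /(schwartz_weight ler01).
rewrite (_ : (fun xi => _) = phi)//; apply/funext => x.
by rewrite /weight powRr0 mul1r.
Qed.

Lemma schwartz_bounded phi : schwartz phi ->
  exists2 M, 0 <= M & forall x, `|re phi x| <= M /\ `|im phi x| <= M.
Proof.
move=> [_ sch]; have [M HM] := sch 0%N; exists M.
  by have [h _] := HM 0%N 0%N isT isT 0; rewrite (le_trans _ h).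
by move=> x; have := HM 0%N 0%N isT isT x; rewrite /= !expr0 !mul1r.
Qed.

Lemma integrable_mul_bounded A F M : mu.-integrable setT (EFin \o A) ->
  continuous F -> (forall x, `|F x| <= M) -> 0 <= M ->
  mu.-integrable setT (EFin \o (fun x => A x * F x)).
Proof.
move=> iA cF FM M0.
have mA : measurable_fun setT A by apply/measurable_EFinP; exact: measurable_int iA.
have iMA : mu.-integrable setT (EFin \o (fun x => M * A x)).
  by have := integrableZl measurableT M iA; apply: eq_integrable.
apply: integrable_le_norm iMA _ => //.
  by apply: measurable_funM => //; exact: continuous_measurable_fun.
by move=> x _; rewrite !normrM mulrC (ger0_norm M0) ler_wpM2r.
Qed.

Lemma cintegrable_mul_schwartz f phi : cintegrable f -> schwartz phi ->
  cintegrable (fun x => f x * phi x).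
Proof.
move=> [iA iB] sphi; have [cr ci] := schwartz_continuous sphi.
have [M M0 HM] := schwartz_bounded sphi.
have H1 := integrable_mul_bounded iA cr (fun x => (HM x).1) M0.
have H2 := integrable_mul_bounded iA ci (fun x => (HM x).2) M0.
have H3 := integrable_mul_bounded iB cr (fun x => (HM x).1) M0.
have H4 := integrable_mul_bounded iB ci (fun x => (HM x).2) M0.
split.
- have := integrableB measurableT H1 H4; apply: eq_integrable => // x _.
  by rewrite /= -EFinB; congr EFin; rewrite /re Re_mul.
- have := integrableD measurableT H2 H3; apply: eq_integrable => // x _.
  by rewrite /= -EFinD; congr EFin; rewrite /im Im_mul.
Qed.

Lemma cint_linear z f phi : cintegrable f -> cintegrable phi ->
  cint setT (fun x => z * f x + phi x) = z * cint setT f + cint setT phi.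
Proof.
case: z => p q [i1 i2] [i3 i4].
have sc (d : R) (F : R -> R) : mu.-integrable setT (EFin \o F) ->
    mu.-integrable setT (EFin \o (fun x => d * F x)).
  by move=> iF; have := integrableZl measurableT d iF; apply: eq_integrable.
have pi1 := sc p _ i1; have qi1 := sc q _ i1; have pi2 := sc p _ i2; have qi2 := sc q _ i2.
have a1 : mu.-integrable setT (EFin \o (fun x => p * re f x - q * im f x)).
  by have := integrableB measurableT pi1 qi2; apply: eq_integrable.
have a2 : mu.-integrable setT (EFin \o (fun x => p * im f x + q * re f x)).
  by have := integrableD measurableT pi2 qi1; apply: eq_integrable.
apply: complex_ext; rewrite Re_add + rewrite Im_add.
- rewrite Re_mul /cint /=.
  transitivity (\int[mu]_x ((p * re f x - q * im f x) + re phi x)).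
    by apply: eq_Rintegral => x _; rewrite {1}/re Re_add Re_mul.
  rewrite (RintegralD measurableT a1 i3) (RintegralB measurableT pi1 qi2).
  by rewrite (RintegralZl _ measurableT i1) (RintegralZl _ measurableT i2).
- rewrite Im_mul /cint /=.
  transitivity (\int[mu]_x ((p * im f x + q * re f x) + im phi x)).
    by apply: eq_Rintegral => x _; rewrite {1}/im Im_add Im_mul.
  rewrite (RintegralD measurableT a2 i4) (RintegralD measurableT pi2 qi1).
  by rewrite (RintegralZl _ measurableT i1) (RintegralZl _ measurableT i2).
Qed.

Lemma tempered_fun_dist f : cintegrable f -> tempered (fun_dist f).
Proof.
move=> cf; have [iA iB] := cf; split.
  move=> z phi psi sphi spsi; rewrite /fun_dist.
  rewrite -cint_linear; [|exact: cintegrable_mul_schwartz|exact: cintegrable_mul_schwartz].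
  by congr (cint setT _); apply/funext => x; ring.
have nA : mu.-integrable setT (EFin \o (fun x => `|re f x|)).
  by have := integrable_abse iA; apply: eq_integrable.
have nB : mu.-integrable setT (EFin \o (fun x => `|im f x|)).
  by have := integrable_abse iB; apply: eq_integrable.
have nAB : mu.-integrable setT (EFin \o (fun x => `|re f x| + `|im f x|)).
  by have := integrableD measurableT nA nB; apply: eq_integrable.
(* The modulus is at most the sum of the absolute values of the two parts, each bounded by the same
   integral times [M]; hence the 2. *)
exists 0%N, (2 * \int[mu]_x (`|re f x| + `|im f x|)) => phi M sphi HM.
have M0 x : `|re phi x| <= M /\ `|im phi x| <= M.
  by have := HM 0%N 0%N isT isT x; rewrite /= !expr0 !mul1r.
have [iR iI] := cintegrable_mul_schwartz cf sphi.
have key (F : R -> R) : mu.-integrable setT (EFin \o F) ->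
    (forall x, `|F x| <= (`|re f x| + `|im f x|) * M) ->
    `|\int[mu]_x F x| <= (\int[mu]_x (`|re f x| + `|im f x|)) * M.
  move=> iF FM; apply: (le_trans (le_normr_Rintegral measurableT iF)).
  rewrite -(RintegralZr _ measurableT nAB); apply: le_Rintegral => //.
  - by have := integrable_abse iF; apply: eq_integrable.
  - by have := integrableZr measurableT M nAB; apply: eq_integrable.
apply: le_trans (cabs_le _) _; rewrite -mulrA mulr_natl mulr2n.
apply: lerD; apply: key => // x.
- rewrite /re Re_mul (le_trans (ler_normB _ _))// mulrDl !normrM.
  by rewrite lerD// ler_wpM2l//; have [] := M0 x.
- rewrite /im Im_mul (le_trans (ler_normD _ _))// mulrDl !normrM.
  by rewrite lerD// ler_wpM2l//; have [] := M0 x.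
Qed.

Lemma fourier_fun_inv_fourier P (P1 P2 : R -> R) a b : a < b -> C2_supported a b P P1 P2 ->
  fourier_fun (fun_dist (inv_fourier P)) (fun x => (P x)%:C%C).
Proof.
move=> ab CP; have [dP dP1 cP2 [sP sP1 sP2]] := CP.
have cP := is_derive_continuous dP; split.
  split; apply: continuous_measurable_fun => //.
  exact: cst_continuous.
have iP := integrable_supp cP sP.
have ciP : cintegrable (fun x => (P x)%:C%C).
  split => //; have := @integrable0 _ _ R mu setT; apply: eq_integrable => //.
move=> phi sphi; split; first exact: cintegrable_mul_schwartz.
rewrite fourier_dist_fun_dist; last 2 first.
- exact: cintegrable_inv_fourier CP.
- exact: schwartz_cintegrable.
by congr fun_dist; apply/funext => x; exact: fourier_inv_fourier CP.
Qed.

(** The decay lemmas with [L = b - a] and the common bound 12 for the bump and its scaled second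
    derivative give [24 L / (1 + (L x)^2)] for both transforms. The prefactor [1 / (2 pi)] is
    bounded by 1, and after squaring one of the two factors [1 / (1 + (L x)^2)] is dropped; the
    other integrates to [pi / L]. *)
Lemma L2norm_inv_bump a b : a < b ->
  (L2norm (inv_fourier (bump a b)) <= (Num.sqrt (2 * 24 ^+ 2 * pi * (b - a)))%:E)%E.
Proof.
move=> ab; have L0 : 0 < b - a by rewrite subr_gt0.
have [_ _ c2 [s0 s1 s2]] := C2_supported_bump ab.
have M1 y : `|bump a b y| <= 12 by rewrite (le_trans (bump_le1 y ab))//; lra.
have M2 y : `|bump2 a b y| <= 12 / (b - a) ^+ 2 by exact: bump2_le.
have dC x := cos_transform_decay x ab L0 (@is_derive_bump _ a b) (@is_derive_bump1 _ a b)
  c2 s0 s1 s2 M1 M2.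
have dS x := sin_transform_decay x ab L0 (@is_derive_bump _ a b) (@is_derive_bump1 _ a b)
  c2 s0 s1 s2 M1 M2.
set L := b - a in L0 dC dS *.
have p1 : 0 <= (2 * (pi : R))^-1 <= 1.
  have p2 := @pi_ge2 R; have p0 : 0 < 2 * (pi : R) by lra.
  by rewrite invr_ge0 (ltW p0) invf_le1//=; lra.
have sq (v K : R) : 0 <= K -> `|v| <= K -> ((2 * pi)^-1 * v) ^+ 2 <= K ^+ 2.
  move=> K0 vK; rewrite -[leLHS]real_normK ?num_real//.
  rewrite lerXn2r ?nnegrE// normrM ger0_norm; last by case/andP: p1.
  by rewrite (le_trans _ vK)// ler_piMl//; case/andP: p1.
have D1 x : 1 <= 1 + (L * x) ^+ 2 by rewrite lerDl sqr_ge0.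
have D0 x : 0 < 1 + (L * x) ^+ 2 by exact: lt_le_trans ltr01 (D1 x).
have c00 : 0 <= 2 * 24 ^+ 2 :> R by rewrite mulr_ge0 ?sqr_ge0.
have c0 : 0 <= 2 * 24 ^+ 2 * L ^+ 2 by rewrite mulr_ge0 ?sqr_ge0.
have bnd x : cabs (inv_fourier (bump a b) x) ^+ 2 <= 2 * 24 ^+ 2 * L ^+ 2 * (1 + (L * x) ^+ 2)^-1.
  rewrite cabs_sqr /=.
  have K0 : 0 <= 2 * 12 * L / (1 + (L * x) ^+ 2).
    by rewrite divr_ge0 ?(ltW (D0 x))// mulr_ge0 ?(ltW L0)// mulr_ge0.
  apply: (le_trans (lerD (sq _ _ K0 (dC x)) (sq _ _ K0 (dS x)))).
  have -> : (2 * 12 * L / (1 + (L * x) ^+ 2)) ^+ 2 + (2 * 12 * L / (1 + (L * x) ^+ 2)) ^+ 2 =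
    2 * 24 ^+ 2 * L ^+ 2 * ((1 + (L * x) ^+ 2)^-1 * (1 + (L * x) ^+ 2)^-1) by ring.
  apply: (ler_wpM2l c0); rewrite ler_piMl ?invr_ge0 ?(ltW (D0 x))// invf_le1; [exact: D1|exact: D0].
have pL : 0 <= 2 * 24 ^+ 2 * pi * L.
  by rewrite mulr_ge0 ?(ltW L0)// mulr_ge0 ?pi_ge0.
have EE x : ((`|(cabs (inv_fourier (bump a b) x))%:E|) `^ 2 =
    (cabs (inv_fourier (bump a b) x) ^+ 2)%:E)%E.
  by rewrite abse_EFin poweR_EFin powR_mulrn// real_normK// num_real.
rewrite /L2norm unlock -powR12_sqrt// -poweR_EFin.
under eq_integral do rewrite EE.
apply: gt0_ler_poweR.
- by rewrite invr_ge0.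
- by rewrite in_itv/= leey andbT; apply: integral_ge0 => x _; rewrite lee_fin sqr_ge0.
- by rewrite in_itv/= leey andbT lee_fin.
have -> : (2 * 24 ^+ 2 * pi * L)%:E =
    (\int[mu]_x ((2 * 24 ^+ 2 * L ^+ 2)%:E * ((1 + (L * x) ^+ 2)^-1)%:E))%E.
  rewrite ge0_integralZl_EFin//.
  - by rewrite integral_oneDsqrV// -EFinM; congr EFin; field; rewrite gt_eqF.
  - by move=> x _; rewrite lee_fin invr_ge0 ltW.
  - apply/measurable_EFinP; apply: continuous_measurable_fun.
    by apply: continuous_invf => [|x]; [exact: continuous_oneDsqrM|rewrite gt_eqF].
have mb : measurable_fun setT (fun x => cabs (inv_fourier (bump a b) x) ^+ 2).
  under eq_fun do rewrite cabs_sqr /=.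
  have cb := @continuous_bump R a b; have ib := integrable_supp cb s0.
  have cC := continuous_cos_transform cb ib; have cS := continuous_sin_transform cb ib.
  have cc (c : R) : continuous (fun _ : R => c) by move=> y; exact: cst_continuous.
  have c3 := continuous_mulf (cc (2 * pi)^-1) cC.
  have c4 := continuous_mulf (cc (2 * pi)^-1) cS.
  apply: continuous_measurable_fun; apply: continuous_addf; exact: continuous_mulf.
apply: ge0_le_integral => //.
- by move=> x _; rewrite lee_fin sqr_ge0.
- exact/measurable_EFinP.
- apply: emeasurable_funM => //; apply/measurable_EFinP; apply: continuous_measurable_fun.
  by apply: continuous_invf => [|x]; [exact: continuous_oneDsqrM|rewrite gt_eqF].
- by move=> x _; rewrite -EFinM lee_fin.
Qed.

(** On the Fourier side the weights of exponents [s / 2] and [- (s / 2)] cancel, so the inverse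
    transform of the unweighted bump is a Bessel potential of the packet. The bound therefore
    depends neither on [s] nor on the position of the interval. *)
Lemma sobolev_bump a b s : a < b -> s <= 2 ->
  let P := fun x => weight (- (s / 2)) x * bump a b x in
  [/\ sobolev s (fun_dist (inv_fourier P)),
      fourier_fun (fun_dist (inv_fourier P)) (fun x => (P x)%:C%C) &
      (sobolev_norm s (fun_dist (inv_fourier P)) <=
        (Num.sqrt (2 * 24 ^+ 2 * pi * (b - a)))%:E)%E].
Proof.
move=> ab s2 P; have Cb := C2_supported_bump ab.
have [P1 [P2 CP]] := C2_supported_weight_bump (- (s / 2)) ab.
have bp : bessel_potential s (fun_dist (inv_fourier P)) (inv_fourier (bump a b)).
  split; first split.
  - have [[i1 _] [i2 _]] := (integrableP _ _ _ (cintegrable_inv_fourier ab Cb).1,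
      integrableP _ _ _ (cintegrable_inv_fourier ab Cb).2).
    by split; apply/measurable_EFinP.
  - by rewrite (le_lt_trans (L2norm_inv_bump ab))// ltry.
  move=> phi sphi.
  have sw : cintegrable (fun xi => ((1 + xi ^+ 2) `^ (s / 2))%:C%C * phi xi).
    by apply: schwartz_weight => //; lra.
  have E1 := fourier_dist_fun_dist (cintegrable_inv_fourier ab Cb) (schwartz_cintegrable sphi).
  have E2 := fourier_dist_fun_dist (cintegrable_inv_fourier ab CP) sw.
  apply: (etrans E1); apply: etrans (esym E2).
  rewrite /fun_dist; congr (cint setT _); apply/funext => x.
  rewrite (fourier_inv_fourier x ab Cb) (fourier_inv_fourier x ab CP) mulrA; congr (_ * _).
  rewrite -[RHS]rmorphM /=; congr (_%:C%C).
  have w0 := weight_gt0 (s / 2) x; move: w0.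
  by rewrite /weight powRN => w0; field; rewrite gt_eqF.
split.
- split; last by eexists; exact: bp.
  by apply: tempered_fun_dist; exact: cintegrable_inv_fourier CP.
- exact: fourier_fun_inv_fourier CP.
- apply: le_trans (L2norm_inv_bump ab); apply: ereal_inf_lbound.
  by exists (inv_fourier (bump a b)).
Qed.

End sobolev_bump.

(** * The power measure, and lower bounds for the evolution of a packet *)

Section measure_and_lower_bounds.
Context {R : realType}.
Notation mu := (@lebesgue_measure R).
Implicit Types (P Q g h A B : R -> R) (a b x y xi t L M c s : R) (k : nat).

(** The ratios [x / (x + y)] and [y / (x + y)] lie in [(0, 1]], so each is at most its own power of
    exponent [kappa]; the two ratios add up to 1. *)
Lemma powR_subadditive (kappa x y : R) : 0 < kappa <= 1 -> 0 <= x -> 0 <= y ->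
  (x + y) `^ kappa <= x `^ kappa + y `^ kappa.
Proof.
move=> /andP[k0 k1] x0 y0.
have [->|xn] := eqVneq x 0; first by rewrite add0r lerDr powR_ge0.
have [->|yn] := eqVneq y 0; first by rewrite addr0 lerDl powR_ge0.
have xp : 0 < x by rewrite lt0r xn.
have yp : 0 < y by rewrite lt0r yn.
have S0 : 0 < x + y by rewrite addr_gt0.
have frac z : 0 < z -> z <= x + y -> z / (x + y) * (x + y) `^ kappa <= z `^ kappa.
  move=> z0 zS; have -> : z `^ kappa = (z / (x + y)) `^ kappa * (x + y) `^ kappa.
    by rewrite -powRM ?(ltW S0)// ?divr_ge0 ?(ltW z0) ?(ltW S0)// divfK// gt_eqF.
  rewrite ler_wpM2r ?powR_ge0// ger1_powR// divr_gt0//=.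
  by rewrite ler_pdivrMr// mul1r.
apply: le_trans (lerD (frac x xp _) (frac y yp _)); rewrite ?lerDl ?lerDr//.
by rewrite -mulrDl -mulrDl divff ?mul1r// gt_eqF.
Qed.

(* The supremum over [t] need not be measurable, so the bound is read off the
   definition of the integral as a supremum over simple functions. *)
Lemma integral_lower_bound (m : {measure set (measurableTypeR R) -> \bar R})
    (D A : set (measurableTypeR R)) (f : measurableTypeR R -> \bar R) (c : R) :
  measurable A -> A `<=` D -> 0 <= c ->
  (forall x, D x -> 0 <= f x)%E -> (forall x, A x -> c%:E <= f x)%E ->
  (c%:E * m A <= \int[m]_(x in D) f x)%E.
Proof.
move=> mA AD c0 f0 fc; rewrite integral_mkcond ge0_integralTE; last first.
  by move=> x; rewrite patchE; case: ifPn => //; rewrite inE; exact: f0.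
apply: ereal_sup_ubound => /=.
exists (scale_nnsfun (indic_nnsfun R mA) c0).
  move=> x; change ((c * \1_A x)%:E <= (f \_ D) x)%E.
  rewrite patchE indicE; case: ifPn.
    rewrite inE => Dx; have [xA|xA] := boolP (x \in A).
      by rewrite mulr1; apply: fc; rewrite inE in xA.
    by rewrite mulr0 f0.
  rewrite notin_setE => nDx; rewrite memNset ?mulr0//.
  by move=> Ax; apply: nDx; exact: AD.
by rewrite sintegralrM sintegral_indic.
Qed.

(** An interval carries the increment of [max(0, x)^alpha]. By subadditivity this is at most the
    length to the power [alpha], whence the constant [2^alpha] for a ball of length [2 r]; from the
    origin it equals [b^alpha]. *)
Lemma exists_power_measure (alpha : R) : 0 < alpha <= 1 ->
  exists m : {measure set (measurableTypeR R) -> \bar R},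
    dimensional alpha m /\
    forall b : R, 0 < b -> ((b `^ alpha)%:E <= m `]0%R, b]%classic)%E.
Proof.
move=> /[dup] ha /andP[a0 a1].
(* The image of Lebesgue measure on ]0, +oo[ under [y |-> y^(1/alpha)]. *)
have mD : measurable (`]0%R, +oo[%classic : set (measurableTypeR R)) by [].
pose r : {measure set (measurableTypeR R) -> \bar R} := mrestr mu mD.
pose phi : measurableTypeR R -> measurableTypeR R := fun y => y `^ alpha^-1.
have mphi : measurable_fun setT phi by exact: measurable_powR.
exists (measure_function_pushforward__canonical__measure_function_Measure r mphi).
have an0 : alpha != 0 by rewrite gt_eqF.
have inv1 (y : R) : 0 <= y -> (y `^ alpha^-1) `^ alpha = y.
  by move=> y0; rewrite -powRrM mulVf// powRr1.
have inv2 (y : R) : 0 <= y -> (y `^ alpha) `^ alpha^-1 = y.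
  by move=> y0; rewrite -powRrM mulfV// powRr1.
split.
- exists (2 `^ alpha) => x e e0 /=; rewrite /pushforward /r /mrestr.
  pose p := Num.max 0 (x - e) `^ alpha; pose q := Num.max 0 (x + e) `^ alpha.
  have mono (u v : R) : 0 <= u -> u <= v -> u `^ alpha <= v `^ alpha.
    move=> u0 uv; apply: ge0_ler_powR => //; rewrite ?nnegrE ?(ltW a0)//.
    exact: le_trans uv.
  have pq : p <= q.
    apply: mono; first by rewrite le_max lexx.
    by rewrite ge_max; apply/andP; split; rewrite le_max; apply/orP; [left|right; lra].
  have qp : q - p <= (2 * e) `^ alpha.
    rewrite lerBlDl; apply: le_trans (powR_subadditive ha _ _); last 2 first.
    + by rewrite le_max lexx.
    + by rewrite mulr_ge0// ltW.
    apply: mono; first by rewrite le_max lexx.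
    have [h|h] := leP 0 (x - e).
      by rewrite ge_max; apply/andP; split; lra.
    by rewrite ge_max; apply/andP; split; lra.
  rewrite -powRM// ?(ltW e0)//.
  apply: (@le_trans _ _ (mu `[p, q])).
    apply: le_measure; rewrite ?inE//.
      apply: measurableI => //; rewrite -[X in measurable X]setTI; apply: mphi => //.
      by rewrite ball_itv.
    move=> y [/=]; rewrite ball_itv /= !in_itv/= andbT => /andP[h1 h2] y0.
    have z0 : 0 < y `^ alpha^-1 by exact: powR_gt0.
    rewrite -(inv1 y (ltW y0)); apply/andP; split.
      by apply: mono; rewrite ?le_max ?lexx// ge_max (ltW z0)/= ltW.
    by apply: mono; rewrite ?(ltW z0)// le_max (ltW h2) orbT.
  have /= -> := lebesgue_measure_itv `[p, q].
  by rewrite lte_fin; case: ifP => _; rewrite ?lee_fin ?powR_ge0// -EFinB lee_fin.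
- move=> b b0 /=; rewrite /pushforward /r /mrestr.
  have -> : (b `^ alpha)%:E = mu `]0%R, b `^ alpha].
    have /= -> := lebesgue_measure_itv `]0%R, b `^ alpha].
    by rewrite lte_fin powR_gt0// -EFinB subr0.
  apply: le_measure; rewrite ?inE//.
    apply: measurableI => //; rewrite -[X in measurable X]setTI; exact: mphi.
  move=> y /=; rewrite !in_itv/= => /andP[y0 yb]; rewrite y0; split => //.
  rewrite powR_gt0//= -(inv2 b (ltW b0)).
  by apply: ge0_ler_powR => //; rewrite ?nnegrE ?invr_ge0 ?powR_ge0 ?(ltW a0) ?(ltW y0).
Qed.

Lemma cos1_le (x : R) : `|x| <= 1 -> cos 1 <= cos x.
Proof.
rewrite ler_norml => /andP[x1 x2].
wlog x0 : x x1 x2 / 0 <= x.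
  move=> H; have [x0|x0] := leP 0 x; first exact: H.
  by rewrite -(cosN x); apply: H; lra.
rewrite leNgt; apply/negP; have p2 := @pi_ge2 R.
by rewrite ltr_cos ?in_itv/=; [lra|apply/andP; split; lra|apply/andP; split; lra].
Qed.

(** After rotation by [e^(- i theta)] the modulus dominates the real part, the integral of
    [cos(phase - theta) P], and on the support that cosine is at least [cos 1]. *)
Lemma evolution_lower_bound (m : R) P (P1 P2 : R -> R) a b t y theta :
  a < b -> C2_supported a b P P1 P2 -> (forall xi, 0 <= P xi) ->
  (forall xi, a < xi < b -> `|y * xi + t * `|xi| `^ m - theta| <= 1) ->
  (2 * pi)^-1 * (cos 1 * \int[mu]_xi P xi) <=
    cabs (evolution m (fun xi => (P xi)%:C%C) t y).
Proof.
move=> ab [dP _ _ [sP _ _]] P0 ph.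
have cP := is_derive_continuous dP; have iP := integrable_supp cP sP.
have ciP : cintegrable (fun xi => (P xi)%:C%C).
  split => //; have := @integrable0 _ _ R mu setT; apply: eq_integrable => //.
(* The packet has integrable [fhat], so the evolution is the plain integral and not the dyadic
   limit. *)
rewrite /evolution asboolT// /evolution_integral.
pose p (xi : R) := y * xi + t * `|xi| `^ m.
have mp : measurable_fun setT p.
  apply: measurable_funD; first by apply: measurable_funM.
  apply: measurable_funM => //; apply: (measurableT_comp (measurable_powR m)).
  exact: continuous_measurable_fun (@norm_continuous _ _).
have imul (g : R -> R) : measurable_fun setT g -> (forall x, `|g x| <= 1) ->
    mu.-integrable setT (EFin \o (fun x => g x * P x)).
  move=> mg g1; apply: integrable_le_norm iP _ => //.
    by apply: measurable_funM mg _; exact: continuous_measurable_fun.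
  by move=> x _; rewrite normrM ler_piMl.
have ic : mu.-integrable setT (EFin \o (fun x => cos (p x) * P x)).
  apply: imul => [|x]; last exact: normr_cos_le1.
  exact: measurableT_comp (continuous_measurable_fun (@continuous_cos R)) mp.
have is_ : mu.-integrable setT (EFin \o (fun x => sin (p x) * P x)).
  apply: imul => [|x]; last exact: normr_sin_le1.
  exact: measurableT_comp (continuous_measurable_fun (@continuous_sin R)) mp.
set z := cint setT _.
have Rz : complex.Re z = \int[mu]_x (cos (p x) * P x).
  rewrite /z /cint /=; apply: eq_Rintegral => x _.
  by rewrite /re Re_mul /= mulr0 subr0.
have Iz : complex.Im z = \int[mu]_x (sin (p x) * P x).
  rewrite /z /cint /=; apply: eq_Rintegral => x _.
  by rewrite /im Im_mul /= mulr0 add0r.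
have iZ (d : R) (F : R -> R) : mu.-integrable setT (EFin \o F) ->
    mu.-integrable setT (EFin \o (fun x => d * F x)).
  by move=> iF; have := integrableZl measurableT d iF; apply: eq_integrable.
have i1 := iZ (cos theta) _ ic; have i2 := iZ (sin theta) _ is_.
have key : cos 1 * \int[mu]_xi P xi <= cos theta * complex.Re z + sin theta * complex.Im z.
  rewrite Rz Iz -(RintegralZl _ measurableT iP) -(RintegralZl _ measurableT ic).
  rewrite -(RintegralZl _ measurableT is_) -(RintegralD measurableT i1 i2).
  apply: le_Rintegral => //; first exact: iZ.
    by have := integrableD measurableT i1 i2; apply: eq_integrable.
  move=> x _; rewrite !mulrA -mulrDl.
  have -> : cos theta * cos (p x) + sin theta * sin (p x) = cos (p x - theta).
    by rewrite cosB; ring.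
  have [xab|xab] := boolP (a < x < b); last by rewrite sP// !mulr0.
  by rewrite ler_wpM2r// cos1_le// ph.
(* Cauchy-Schwarz with the unit vector [(cos theta, sin theta)], through the Lagrange identity. *)
have CS : cos theta * complex.Re z + sin theta * complex.Im z <= cabs z.
  have c0 : 0 <= cabs z by exact: le_trans (normr_Re_le z).
  rewrite (le_trans (ler_norm _))// -(ger0_norm c0) -ler_sqr ?nnegrE//.
  rewrite !real_normK ?num_real// cabs_sqr -subr_ge0.
  have := cos2Dsin2 theta; set C := cos theta; set S := sin theta => CS1.
  set u := complex.Re z; set v := complex.Im z.
  have -> : u ^+ 2 + v ^+ 2 - (C * u + S * v) ^+ 2 =
    (1 - (C ^+ 2 + S ^+ 2)) * (u ^+ 2 + v ^+ 2) + (S * u - C * v) ^+ 2 by ring.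
  by rewrite CS1 subrr mul0r add0r sqr_ge0.
have p0 : 0 <= (2 * (pi : R))^-1 by rewrite invr_ge0 mulr_ge0 ?pi_ge0.
apply: le_trans (_ : (2 * pi)^-1 * cabs z <= _); first by rewrite ler_wpM2l// (le_trans key).
rewrite -ler_sqr ?nnegrE ?mulr_ge0//; last 2 first.
- by exact: le_trans (normr_Re_le z).
- by exact: le_trans (normr_Re_le _).
by rewrite exprMn !cabs_sqr Re_mul Im_mul /= !mul0r subr0 addr0 !exprMn mulrDr.
Qed.

(** On [[M, 2 M]] with [M >= 1] one has [M^2 <= 1 + x^2 <= 5 M^2]. The left inequality serves
    [c >= 0], the right one [c < 0], and [5^(- |c|)] covers both signs. *)
Lemma weight_lower_bound c : exists2 K : R, 0 < K & forall M x : R,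
  1 <= M -> M <= x <= 2 * M -> K * M `^ (2 * c) <= weight c x.
Proof.
exists (5 `^ (- `|c|)); first by rewrite powR_gt0.
move=> M x M1 /andP[Mx xM].
have M0 : 0 < M by exact: lt_le_trans M1.
have q1 : M ^+ 2 <= 1 + x ^+ 2 by nra.
have q2 : 1 + x ^+ 2 <= 5 * M ^+ 2 by nra.
have M20 : 0 < M ^+ 2 by rewrite exprn_gt0.
have E : M `^ (2 * c) = (M ^+ 2) `^ c by rewrite powRrM powR_mulrn// ltW.
rewrite E /weight; have [c0|c0] := leP 0 c.
- rewrite (@le_trans _ _ ((M ^+ 2) `^ c))//.
    rewrite ler_piMl ?powR_ge0// ger0_norm//.
    by rewrite powRN invf_le1 ?powR_gt0// -[leLHS](powRr0 5) ler_powR//; lra.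
  by apply: ge0_ler_powR => //; rewrite nnegrE; lra.
- have -> : - `|c| = c by rewrite ltr0_norm// opprK.
  rewrite -powRM//; last by lra.
  rewrite -[c]opprK !(powRN _ (- c)) lef_pV2 ?posrE ?powR_gt0//; [|lra|lra].
  by apply: ge0_ler_powR; rewrite ?nnegrE; lra.
Qed.

(** Only the middle half, of length [L / 2], is counted, where the bump is at least [8^(-3)];
    [L <= M] keeps the interval inside [[M, 2 M]]. *)
Lemma Rintegral_weight_bump_lower_bound c : exists2 K : R, 0 < K & forall M L : R,
  1 <= M -> 0 < L -> L <= M ->
  K * M `^ (2 * c) * L <= \int[mu]_x (weight c x * bump M (M + L) x).
Proof.
have [K K0 HK] := weight_lower_bound c.
exists (K * (8^-1) ^+ 3 / 2).
  by rewrite divr_gt0// mulr_gt0// exprn_gt0// invr_gt0.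
move=> M L M1 L0 LM; set a := M; set b := M + L.
have ab : a < b by rewrite ltrDl.
have cw := @continuous_weight R c; have cb := @continuous_bump R a b.
have sP : supported a b (fun x => weight c x * bump a b x).
  by move=> x xab; rewrite supported_bump// mulr0.
have iP := integrable_supp (continuous_mulf cw cb) sP.
set u := a + L / 4; set v := b - L / 4.
have uv : u <= v by rewrite /u /v /b /a; lra.
apply: (@le_trans _ _ (\int[mu]_(x in `[u, v]) (K * M `^ (2 * c) * (8^-1) ^+ 3))).
  rewrite Rintegral_cst//; have /= -> := lebesgue_measure_itv `[u, v].
  have -> : (fine (if (u%:E < v%:E)%E then (v%:E - u%:E)%E else 0%E)) = L / 2.
    rewrite lte_fin ifT -?EFinB /=; last by rewrite /u /v /b /a; lra.
    by rewrite /u /v /b /a; field.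
  by rewrite le_eqVlt; apply/orP; left; apply/eqP; field.
rewrite Rintegral_mkcond; apply: le_Rintegral => //.
  have iC : mu.-integrable `[u, v] (EFin \o cst (K * M `^ (2 * c) * (8^-1) ^+ 3)).
    by apply: continuous_integrable_itv => x; exact: cst_continuous.
  rewrite -restrict_EFin; exact/(integrable_mkcond _ _).1.
move=> x _; rewrite patchE; case: ifPn => [|_]; last first.
  by rewrite mulr_ge0 ?bump_ge0// ltW// weight_gt0.
rewrite inE/= in_itv/= => xuv; have bL : b - a = L by rewrite /b /a; ring.
apply: ler_pM.
- by rewrite mulr_ge0 ?powR_ge0// ltW.
- by rewrite exprn_ge0// invr_ge0.
- apply: HK => //; case/andP: xuv; rewrite /u /v /b /a => h1 h2.
  by apply/andP; split; lra.
- by apply: bump_middle => //; rewrite bL.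
Qed.

End measure_and_lower_bounds.

(** * The test curves and the necessary condition drawn from packets *)

Section necessary_condition.
Context {R : realType}.
Implicit Types (a b x y t L M c s : R).

(** [c = 0] gives the vertical lines and [c = 1] the curve of the third regime, so one membership
    proof serves both. For fixed [t] it is a translation in [x], hence bilipschitz with constant
    1. *)
Definition shear (c kappa x t : R) : R := x - c * `|t| `^ kappa.

Lemma normr_powR_holder (kappa t u : R) : 0 < kappa <= 1 ->
  `| `|t| `^ kappa - `|u| `^ kappa| <= `|t - u| `^ kappa.
Proof.
move=> hk; have k0 : 0 <= kappa by case/andP: hk => /ltW.
have half (v w : R) : `|v| `^ kappa <= `|v - w| `^ kappa + `|w| `^ kappa.
  apply: le_trans (powR_subadditive hk _ _) => //.
  apply: ge0_ler_powR => //; rewrite ?nnegrE ?addr_ge0//.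
  by rewrite -[in leLHS](subrK w v) ler_normD.
rewrite ler_norml; apply/andP; split.
  by rewrite lerNl opprB lerBlDr distrC half.
by rewrite lerBlDr half.
Qed.

Lemma continuous_normr_powR (kappa : R) : 0 < kappa <= 1 ->
  continuous (fun t : R => `|t| `^ kappa).
Proof.
move=> hk t; have k0 : 0 < kappa by case/andP: hk.
apply/cvgrPdist_lt => e e0.
have d0 : 0 < e `^ kappa^-1 by exact: powR_gt0.
have := nbhsx_ballx t _ d0; apply: filterS => u; rewrite -ball_normE /= => tu.
apply: le_lt_trans (normr_powR_holder _ _ hk) _.
have -> : e = (e `^ kappa^-1) `^ kappa.
  by rewrite -powRrM mulVf ?gt_eqF// powRr1// ltW.
by apply: gt0_ltr_powR => //; rewrite nnegrE ?powR_ge0.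
Qed.

Lemma Gamma_class_shear (c kappa : R) : 0 <= c <= 1 -> 0 < kappa <= 1 ->
  Gamma_class kappa (shear c kappa).
Proof.
move=> /andP[c0 c1] hk; have k0 : 0 < kappa by case/andP: hk.
split.
- apply: continuous_subspaceT => p.
  apply: cvgB; first exact: cvg_fst.
  apply: cvgMr; apply: (@cvg_comp _ _ _ snd (fun t : R => `|t| `^ kappa)).
    exact: cvg_snd.
  exact: continuous_normr_powR.
- by move=> x; rewrite /shear normr0 powR0 ?gt_eqF// mulr0 subr0.
- exists 1, 1; split => // [x t t' _ _|t x x' _].
    rewrite mul1r /shear.
    have -> : x - c * `|t| `^ kappa - (x - c * `|t'| `^ kappa) =
      c * (`|t'| `^ kappa - `|t| `^ kappa) by ring.
    rewrite normrM (ger0_norm c0) distrC.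
    by rewrite (le_trans _ (normr_powR_holder _ _ hk))// ler_piMl.
  have -> : shear c kappa x t - shear c kappa x' t = x - x' by rewrite /shear; ring.
  by rewrite invr1 !mul1r.
Qed.

(** The body repeats the inequality of the theorem, so that the final proof matches it by
    conversion. *)
Definition estimate (m s : R) (gamma : R -> R -> R)
    (mu : {measure set (measurableTypeR R) -> \bar R}) (C : R) : Prop :=
  forall (f : (R -> R[i]%C) -> R[i]%C) (fhat : R -> R[i]%C),
    sobolev s f -> fourier_fun f fhat ->
    ((\int[mu]_(x in `[(-1)%R, 1%R]%classic)
       ereal_sup [set ((cabs (evolution m fhat t (gamma x t)) ^+ 2)%R)%:E
                 | t in `[(-1)%R, 1%R]%classic]) `^ (2^-1)%R
    <= C%:E * sobolev_norm s f)%E.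

(** In squared form the left side is at least [v^2 b^alpha] with [v = k M^(-s) L], and the right
    side at most [C^2 A L]; one factor [L] cancels. The point is that [K] does not depend on [M],
    [L], [b], so that [M] can be sent to infinity. *)
Lemma estimate_bound (m s alpha : R) gamma
    (mu : {measure set (measurableTypeR R) -> \bar R}) (C : R) : s <= 2 -> 0 < alpha ->
  (forall b : R, 0 < b -> ((b `^ alpha)%:E <= mu `]0%R, b]%classic)%E) ->
  estimate m s gamma mu C ->
  exists K : R, forall M L b : R, 1 <= M -> 0 < L -> L <= M -> 0 < b -> b <= 1 ->
    (forall x, 0 < x <= b -> exists t theta : R, -1 <= t <= 1 /\
      forall xi, M < xi < M + L ->
        `|gamma x t * xi + t * `|xi| `^ m - theta| <= 1) ->
    L * M `^ (- (2 * s)) * b `^ alpha <= K.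
Proof.
move=> s2 a0 hmu est.
have [K0 K00 HK0] := @Rintegral_weight_bump_lower_bound R (- (s / 2)).
have pi0 : 0 < (pi : R) by exact: pi_gt0.
pose k : R := (2 * pi)^-1 * (cos 1 * K0).
have k0 : 0 < k by rewrite mulr_gt0 ?mulr_gt0 ?invr_gt0 ?cos1_gt0// mulr_gt0.
pose A : R := 2 * 24 ^+ 2 * pi.
have A0 : 0 <= A by rewrite !mulr_ge0 ?sqr_ge0// ltW.
(* The sign of [C] is unknown, hence the absolute value before squaring. *)
exists (`|C| ^+ 2 * A / k ^+ 2) => M L b M1 L0 LM b0 b1 hyp.
have M0 : 0 < M by exact: lt_le_trans M1.
have ab : M < M + L by rewrite ltrDl.
pose P (x : R) := weight (- (s / 2)) x * bump M (M + L) x.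
have [sob four nrm] := sobolev_bump ab s2.
have [P1 [P2 CP]] := C2_supported_weight_bump (- (s / 2)) ab.
have P0 xi : 0 <= P xi by rewrite mulr_ge0 ?bump_ge0// ltW// weight_gt0.
pose v := k * M `^ (- s) * L.
have v0 : 0 < v by rewrite mulr_gt0// mulr_gt0// powR_gt0.
have Hest := est _ _ sob four.
set I := (\int[mu]_(x in _) _)%E in Hest.
have lowI : ((v ^+ 2 * b `^ alpha)%:E <= I)%E.
  rewrite EFinM; apply: (@le_trans _ _ ((v ^+ 2)%:E * mu `]0%R, b]%classic)%E).
    by apply: lee_wpmul2l; [rewrite lee_fin sqr_ge0|exact: hmu].
  apply: integral_lower_bound.
  - exact: measurable_itv.
  - move=> x /=; rewrite !in_itv/= => /andP[x0 xb].
    by apply/andP; split; lra.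
  - exact: sqr_ge0.
  (* A supremum in the extended reals is nonnegative only once some member is exhibited; time 0 is
     always allowed. *)
  - move=> x _; apply: (@le_trans _ _
      ((cabs (evolution m (fun xi => (P xi)%:C%C) 0 (gamma x 0)) ^+ 2)%:E)).
      by rewrite lee_fin sqr_ge0.
    by apply: ereal_sup_ubound; exists 0 => //=; rewrite in_itv/=; apply/andP; split; lra.
  - move=> x /=; rewrite in_itv/= => xb; have [t [theta [t1 ph]]] := hyp x xb.
    apply: (@le_trans _ _ ((cabs (evolution m (fun xi => (P xi)%:C%C) t (gamma x t)) ^+ 2)%:E)).
      have H := evolution_lower_bound ab CP P0 ph.
      have vle : v <= cabs (evolution m (fun xi => (P xi)%:C%C) t (gamma x t)).
        apply: le_trans H; rewrite /v /k -!mulrA ler_pM2l ?invr_gt0 ?mulr_gt0//.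
        rewrite ler_pM2l ?cos1_gt0// mulrA.
        have -> : - s = 2 * - (s / 2) by field.
        exact: HK0.
      rewrite lee_fin ler_sqr// nnegrE; first exact: ltW.
      exact: le_trans (ltW v0) vle.
    by apply: ereal_sup_ubound; exists t => //=; rewrite in_itv/=.
have vb0 : 0 <= v ^+ 2 * b `^ alpha by rewrite mulr_ge0 ?sqr_ge0 ?powR_ge0.
have n0 : (0 <= sobolev_norm s (fun_dist (inv_fourier P)))%E.
  by apply: le_ereal_inf_tmp => _ [u _ <-]; exact: Lnorm_ge0.
have S1 : (Num.sqrt (v ^+ 2 * b `^ alpha) <= `|C| * Num.sqrt (A * L)).
  rewrite -lee_fin -powR12_sqrt// -poweR_EFin.
  apply: (@le_trans _ _ (I `^ 2^-1)%E).
    apply: gt0_ler_poweR => //.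
    - by rewrite in_itv/= leey andbT lee_fin.
    - by rewrite in_itv/= leey andbT (le_trans _ lowI)// lee_fin.
  apply: (le_trans Hest).
  apply: (@le_trans _ _ (`|C|%:E * sobolev_norm s (fun_dist (inv_fourier P)))%E).
    by apply: lee_wpmul2r => //; rewrite lee_fin ler_norm.
  rewrite EFinM; apply: lee_wpmul2l; first by rewrite lee_fin.
  by move: nrm; have -> : M + L - M = L by ring.
have AL0 : 0 <= A * L by exact: mulr_ge0 A0 (ltW L0).
have S2 : v ^+ 2 * b `^ alpha <= `|C| ^+ 2 * (A * L).
  rewrite -(sqr_sqrtr vb0) -[X in _ <= _ * X](sqr_sqrtr AL0).
  by rewrite -exprMn ler_sqr ?nnegrE ?mulr_ge0 ?sqrtr_ge0.
rewrite ler_pdivlMr ?exprn_gt0//.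
have E : M `^ (- (2 * s)) = (M `^ (- s)) ^+ 2.
  by rewrite -powR_mulrn ?powR_ge0// -powRrM; congr (_ `^ _); ring.
rewrite E -(ler_pM2r L0); move: S2; rewrite /v.
have -> : (k * M `^ (- s) * L) ^+ 2 * b `^ alpha =
  L * (M `^ (- s)) ^+ 2 * b `^ alpha * k ^+ 2 * L by ring.
by rewrite !mulrA.
Qed.

Lemma powR_unbounded (delta c K : R) : 0 < delta -> 0 < c ->
  exists2 M : R, 1 <= M & K < c * M `^ delta.
Proof.
move=> d0 c0; pose B : R := (`|K| + 1) / c + 1.
have B1 : 1 <= B by rewrite lerDr divr_ge0 ?(ltW c0)// addr_ge0.
exists (B `^ delta^-1).
  by rewrite -[leLHS](powRr0 B) ler_powR// invr_ge0 ltW.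
rewrite -powRrM mulVf ?gt_eqF// powRr1; last by rewrite (le_trans ler01).
rewrite /B mulrDr mulr1 mulrC divfK ?gt_eqF//.
by have := ler_norm K; lra.
Qed.

(** The exponent is raised to a natural number [N >= p], and [(1 + d)^N <= 1 + 3^N d] follows by
    induction: [(1 + d) (1 + q d) <= 1 + 3 q d] when [q >= 1] and [d <= 1]. *)
Lemma powR_tangent_bound (p : R) : 0 < p -> exists2 K : R, 1 <= K &
  forall d : R, 0 <= d <= 1 -> (1 + d) `^ p - 1 <= K * d.
Proof.
move=> p0; pose N := Num.bound p.
have pN : p <= N%:R by rewrite ltW// archi_boundP// ltW.
exists (3 ^+ N); first by rewrite exprn_ege1//; lra.
move=> d /andP[d0 d1].
have d11 : 1 <= 1 + d by rewrite lerDl.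
rewrite lerBlDl (le_trans (ler_powR d11 pN))// powR_mulrn; last by lra.
elim: N {pN} => [|n IH]; first by rewrite !expr0; lra.
have h3 : 1 <= 3 ^+ n :> R by rewrite exprn_ege1//; lra.
rewrite !exprS.
apply: le_trans (_ : (1 + d) * (1 + 3 ^+ n * d) <= _).
  by rewrite ler_wpM2l//; lra.
move: h3; set q := 3 ^+ n => h3; rewrite -subr_ge0.
have -> : 1 + 3 * q * d - (1 + d) * (1 + q * d) = d * ((q - 1) + q * (1 - d)) by ring.
by rewrite mulr_ge0// addr_ge0 ?mulr_ge0 ?subr_ge0// (le_trans ler01).
Qed.

End necessary_condition.

(** * The three counterexamples *)

Section three_regimes.
Context {R : realType}.
Implicit Types (m kappa alpha s C : R) (mu : {measure set (measurableTypeR R) -> \bar R}).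

(* Packets of width [sqrt M] at frequency [M] travel at speed [m M^(m-1)], so at
   time [t = - x / (m M^(m-1))] the phase is stationary at [x]. *)
Lemma no_estimate_stationary_phase m kappa alpha s C mu : 1 < m ->
  0 < kappa <= 1 -> 0 < alpha <= 1 ->
  (forall b : R, 0 < b -> ((b `^ alpha)%:E <= mu `]0%R, b]%classic)%E) ->
  s < 1 / 4 -> ~ estimate m s (shear 0 kappa) mu C.
Proof.
move=> m1 hk ha hmu s4 est; have a0 : 0 < alpha by case/andP: ha.
have s2 : s <= 2 by lra.
have [K HK] := estimate_bound s2 a0 hmu est.
have [Q Q1 HQ] := @powR_tangent_bound R (m - 1) ltac:(lra).
have Q0 : 0 < Q by exact: lt_le_trans Q1.
have d0 : 0 < 2^-1 - 2 * s by lra.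
have c0 : 0 < Q^-1 `^ 2^-1 by rewrite powR_gt0// invr_gt0.
have [M M1 HM] := powR_unbounded K d0 c0.
have M0 : 0 < M by exact: lt_le_trans M1.
(* Chosen so that [Q L^2 / M = 1], which is the bound found below for the drift of the phase across
   the packet; [Q >= 1] gives [L <= M]. *)
pose L := (M / Q) `^ 2^-1.
have MQ0 : 0 < M / Q by exact: divr_gt0.
have L0 : 0 < L by exact: powR_gt0.
have L2 : L ^+ 2 = M / Q.
  by rewrite -powR_mulrn ?powR_ge0// -powRrM mulVf ?pnatr_eq0// powRr1// ltW.
have LM : L <= M.
  rewrite -ler_sqr ?nnegrE ?(ltW L0) ?(ltW M0)// L2 ler_pdivrMr// expr2 -mulrA.
  by rewrite ler_peMr ?(ltW M0)//; nra.
have mp : 1 <= m * M `^ (m - 1).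
  have p1 : 1 <= M `^ (m - 1) by rewrite -[leLHS](powRr0 M) ler_powR//; lra.
  by nra.
have mp0 : 0 < m * M `^ (m - 1) by exact: lt_le_trans mp.
have := HK M L 1 M1 L0 LM ltr01 (lexx 1); rewrite powR1 mulr1 => H.
suff : L * M `^ (- (2 * s)) <= K.
  rewrite /L powRM ?invr_ge0 ?(ltW M0) ?(ltW Q0)//.
  rewrite mulrAC -powRD ?(lt0r_neq0 M0) ?implybT// mulrC.
  by rewrite leNgt HM.
apply: H => x /andP[x0 x1].
pose t := - (x / (m * M `^ (m - 1))).
pose g (z : R) := x * z + t * z `^ m.
exists t, (g M); split.
  have t1 : x / (m * M `^ (m - 1)) <= 1 by rewrite ler_pdivrMr// mul1r (le_trans x1).
  have t0 : 0 <= x / (m * M `^ (m - 1)) by rewrite divr_ge0// ltW.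
  by rewrite /t; apply/andP; split; lra.
move=> xi /andP[Mxi xiL].
have xi0 : 0 < xi by exact: lt_trans Mxi.
rewrite /shear mul0r subr0 (gtr0_norm xi0) -/(g xi).
have dg (z : R) : 0 < z -> is_derive z 1 g (x + t * (m * z `^ (m - 1))).
  move=> z0; have E := is_derive_add
    (is_derive_mul (is_derive_cst z x) (is_derive_id z 1))
    (is_derive_mul (is_derive_cst z t) (is_derive1_powR m z0)).
  by apply: (is_derive_eq E); ring.
have cg : {within `[M, xi], continuous g}.
  apply: derivable_within_continuous => z; rewrite in_itv/= => /andP[Mz _].
  exact: (@ex_derive _ _ _ _ _ _ _ (dg z (lt_le_trans M0 Mz))).
have dg' (z : R) : z \in `]M, xi[ -> is_derive z 1 g (x + t * (m * z `^ (m - 1))).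
  by rewrite in_itv/= => /andP[Mz _]; apply: dg; exact: lt_trans Mz.
(* The derivative of the phase at [z] is [x (1 - (z / M)^(m-1))], zero at [M] and of size at most
   [Q L / M] on the packet; the mean value theorem adds another factor [L]. *)
have [z zM ->] := MVT Mxi dg' cg.
move: zM; rewrite in_itv/= => /andP[Mz zxi].
pose d := (z - M) / M.
have d01 : 0 <= d <= 1.
  by rewrite /d divr_ge0 ?subr_ge0 ?(ltW Mz) ?(ltW M0)//= ler_pdivrMr// mul1r; lra.
have zE : z = M * (1 + d) by rewrite /d; field; rewrite gt_eqF.
have D1 : 0 <= 1 + d by case/andP: d01 => ? _; lra.
have -> : x + t * (m * z `^ (m - 1)) = - (x * ((1 + d) `^ (m - 1) - 1)).
  rewrite zE powRM ?(ltW M0)// /t; move: (powR_gt0 (m - 1) M0); set w := M `^ (m - 1).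
  have mn : m != 0 by rewrite gt_eqF// (lt_trans ltr01).
  by move=> w0; field; rewrite mn gt_eqF.
rewrite mulNr normrN.
have P0 : 0 <= (1 + d) `^ (m - 1) - 1.
  rewrite subr_ge0 -[leLHS](powRr0 (1 + d)) ler_powR//; last by lra.
  by rewrite lerDl; case/andP: d01.
have xP0 := mulr_ge0 (ltW x0) P0.
have Mxi0 : 0 <= xi - M by rewrite subr_ge0 ltW.
rewrite (ger0_norm (mulr_ge0 xP0 Mxi0)).
apply: (@le_trans _ _ ((Q * (L / M)) * L)); last first.
  have -> : Q * (L / M) * L = Q * L ^+ 2 / M by ring.
  by rewrite L2 le_eqVlt; apply/orP; left; apply/eqP; field; rewrite !gt_eqF.
apply: ler_pM => //; last by lra.
apply: (@le_trans _ _ ((1 + d) `^ (m - 1) - 1)); first by rewrite ler_piMl.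
apply: (le_trans (HQ _ d01)); rewrite ler_pM2l// /d ler_pM2r ?invr_gt0//; lra.
Qed.

(** At time 0 the evolution is the packet itself, which with [L = M] does not oscillate within
    distance [1 / (2 M)] of the origin, since [xi <= 2 M]. The test reduces to the mass of that
    neighbourhood, of order [M^(- alpha)]. *)
Lemma no_estimate_time_zero m kappa alpha s C mu : 1 < m ->
  0 < kappa <= 1 -> 0 < alpha <= 1 ->
  (forall b : R, 0 < b -> ((b `^ alpha)%:E <= mu `]0%R, b]%classic)%E) ->
  s < (1 - alpha) / 2 -> ~ estimate m s (shear 0 kappa) mu C.
Proof.
move=> m1 hk ha hmu s4 est; have a0 : 0 < alpha by case/andP: ha.
have s2 : s <= 2 by lra.
have [K HK] := estimate_bound s2 a0 hmu est.
have d0 : 0 < 1 - 2 * s - alpha by lra.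
have c0 : 0 < 2 `^ (- alpha) :> R by exact: powR_gt0.
have [M M1 HM] := powR_unbounded K d0 c0.
have M0 : 0 < M by exact: lt_le_trans M1.
have M20 : 0 < 2 * M by rewrite mulr_gt0.
have b0 : 0 < (2 * M)^-1 by rewrite invr_gt0.
have b1 : (2 * M)^-1 <= 1 by rewrite invf_le1//; lra.
have H := HK M M _ M1 M0 (lexx M) b0 b1.
suff : M * M `^ (- (2 * s)) * (2 * M)^-1 `^ alpha <= K.
  rewrite -[(2 * M)^-1]powR_inv1 ?(ltW M20)// -powRrM mulN1r powRM ?(ltW M0)//.
  rewrite -{1}[M]powRr1 ?(ltW M0)// mulrCA -!powRD ?(lt0r_neq0 M0) ?implybT//.
  by rewrite leNgt HM.
apply: H => x /andP[x0 xb]; exists 0, 0; split; first by apply/andP; split; lra.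
move=> xi /andP[Mxi xiL].
rewrite /shear !mul0r !subr0 addr0 ger0_norm; last by rewrite mulr_ge0; lra.
have -> : 1 = (2 * M)^-1 * (2 * M) by rewrite mulVf// gt_eqF.
by apply: ler_pM; lra.
Qed.

(* Along [t = x^(1/kappa)] the curve [x - |t|^kappa] sits at the origin, and the
   phase is [t |xi|^m <= 1] as long as [x <= (2M)^(-m kappa)]. *)
Lemma no_estimate_curve m kappa alpha s C mu : 1 < m ->
  0 < kappa <= 1 -> 0 < alpha <= 1 ->
  (forall b : R, 0 < b -> ((b `^ alpha)%:E <= mu `]0%R, b]%classic)%E) ->
  s < (1 - m * alpha * kappa) / 2 ->
  ~ estimate m s (shear 1 kappa) mu C.
Proof.
move=> m1 hk ha hmu s4 est; have a0 : 0 < alpha by case/andP: ha.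
have k0 : 0 < kappa by case/andP: hk.
have mak : 0 < m * alpha * kappa by rewrite !mulr_gt0// (lt_trans ltr01).
have s2 : s <= 2 by lra.
have [K HK] := estimate_bound s2 a0 hmu est.
have d0 : 0 < 1 - 2 * s - m * alpha * kappa by lra.
have c0 : 0 < 2 `^ (- (m * alpha * kappa)) :> R by exact: powR_gt0.
have [M M1 HM] := powR_unbounded K d0 c0.
have M0 : 0 < M by exact: lt_le_trans M1.
have M20 : 0 < 2 * M by rewrite mulr_gt0.
have mk : 0 <= m * kappa by rewrite mulr_ge0 ?(ltW k0)// ltW// (lt_trans ltr01).
pose b := (2 * M) `^ (- (m * kappa)).
have b0 : 0 < b by exact: powR_gt0.
have b1 : b <= 1 by rewrite /b -[leRHS](powRr0 (2 * M)) ler_powR; lra.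
have H := HK M M _ M1 M0 (lexx M) b0 b1.
suff : M * M `^ (- (2 * s)) * b `^ alpha <= K.
  rewrite /b -powRrM (_ : - (m * kappa) * alpha = - (m * alpha * kappa)); last by ring.
  rewrite powRM ?(ltW M0)//.
  rewrite -{1}[M]powRr1 ?(ltW M0)// mulrCA -!powRD ?(lt0r_neq0 M0) ?implybT//.
  by rewrite leNgt HM.
apply: H => x /andP[x0 xb]; exists (x `^ kappa^-1), 0.
have t0 : 0 <= x `^ kappa^-1 by exact: powR_ge0.
have kn : kappa != 0 by rewrite gt_eqF.
(* This is where the size of [b] comes from: [(2 M)^(- m)] is the inverse of the bound [(2 M)^m] for
   [|xi|^m] on the packet. *)
have tb : x `^ kappa^-1 <= (2 * M) `^ (- m).
  have -> : - m = - (m * kappa) * kappa^-1 by field.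
  by rewrite powRrM; apply: ge0_ler_powR; rewrite ?nnegrE ?invr_ge0 ?(ltW k0) ?(ltW x0) ?(ltW b0).
have tb1 : (2 * M) `^ (- m) <= 1.
  by rewrite -[leRHS](powRr0 (2 * M)) ler_powR; lra.
split; first by apply/andP; split; lra.
move=> xi /andP[Mxi xiL].
rewrite /shear mul1r (ger0_norm t0) -powRrM mulVf// powRr1 ?(ltW x0)// subrr mul0r add0r subr0.
rewrite ger0_norm; last by rewrite mulr_ge0// powR_ge0.
have -> : 1 = (2 * M) `^ (- m) * (2 * M) `^ m by rewrite powRN mulVf// gt_eqF// powR_gt0.
apply: ler_pM; rewrite ?powR_ge0//.
by apply: ge0_ler_powR; rewrite ?nnegrE ?normr_ge0 ?ger0_norm//; lra.
Qed.

End three_regimes.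

Theorem mainTheorem5 (R : realType) (m kappa alpha s : R)
  (hm : 1 < m) (hkappa : 0 < kappa <= 1) (halpha : 0 < alpha <= 1)
  (hs : s < Num.max (1 / 4)
              (Num.max ((1 - alpha) / 2) ((1 - m * alpha * kappa) / 2))) :
  exists (gamma : R -> R -> R)
         (mu : {measure set (measurableTypeR R) -> \bar R}),
    [/\ Gamma_class kappa gamma, dimensional alpha mu &
      ~ exists C : R, forall (f : (R -> R[i]%C) -> R[i]%C) (fhat : R -> R[i]%C),
          sobolev s f -> fourier_fun f fhat ->
          ((\int[mu]_(x in `[(-1)%R, 1%R]%classic)
              ereal_sup [set ((cabs (evolution m fhat t (gamma x t)) ^+ 2)%R)%:E
                        | t in `[(-1)%R, 1%R]%classic]) `^ (2^-1)%R
           <= C%:E * sobolev_norm s f)%E].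
Proof.
have ha := halpha; have hk := hkappa.
(* The measure is fixed before the cases are separated; only the curve depends on which term of the
   maximum exceeds [s]. *)
have [mu [dmu hmu]] := exists_power_measure ha.
have c0 : (0 : R) <= (0 : R) <= 1 by rewrite lexx ler01.
have c1 : (0 : R) <= (1 : R) <= 1 by rewrite ler01 lexx.
move: hs; rewrite !lt_max => /or3P[s1|s2|s3].
- exists (shear 0 kappa), mu; split => //; first exact: Gamma_class_shear.
  by move=> [C est]; exact: (no_estimate_stationary_phase hm hk ha hmu s1 est).
- exists (shear 0 kappa), mu; split => //; first exact: Gamma_class_shear.
  by move=> [C est]; exact: (no_estimate_time_zero hm hk ha hmu s2 est).
- exists (shear 1 kappa), mu; split => //; first exact: Gamma_class_shear.
  by move=> [C est]; exact: (no_estimate_curve hm hk ha hmu s3 est).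
Qed.
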